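(* Let $G$ be a countable amenable group and let $((F_N),a,b)$ be an averaging scheme. Let $\{f_1,\dots,f_\ell\}$, $f_i:G\to\mathbb{D}$, be a family of functions on $G$ that is accordant with $((F_N),a,b)$, and let $\mathbb{X}=(X,\mathcal{B}_X,\mu,(T_g)_{g\in G})$ be a Furstenberg system for the tuple $(\{f_1,\dots,f_\ell\},(F_N),a,b)$. Then $\mathbb{X}$ is isomorphic to the system $\mathbb{Y}=(Y,\mathcal{B}_Y,\nu,(S_g)_{g\in G})$, where $Y=(\mathbb{D}^\ell)^G$ with the product topology, $(S_gx)_{g_0}=(x_1(g_0g),\dots,x_\ell(g_0g))$ for all $g,g_0\in G$ and $x=(x_1(h),\dots,x_\ell(h))_{h\in G}\in Y$, $\omega=(f_1(g),\dots,f_\ell(g))_{g\in G}$, $\nu=\textrm{w*-}\lim_{N\to\infty}\frac{1}{b(N)|F_N|}\sum_{g\in F_N}a(g)\delta_{S_g\omega}$ (weak* limit), and $\mathcal{B}_Y$ is the completion of the Borel $\sigma$-algebra of $Y$.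
   Context: $\mathbb{D}$ is the closed unit disk in $\mathbb{C}$, $\ell\in\mathbb{N}$. A (left) F\o lner sequence in $G$ is a sequence $(F_N)$ of finite non-empty subsets with $\lim_{N\to\infty}|F_N\,\Delta\, gF_N|/|F_N|=0$ for all $g\in G$; $G$ is amenable if it admits one. A measure preserving system is a probability space with a measure preserving action $(T_g)_{g\in G}$ of $G$ ($T_gT_h=T_{gh}$); it is standard if the probability space is a Lebesgue space (in particular complete). For a function $F$ on $X$, $T_gF=F\circ T_g$. An averaging scheme is a triple $((F_N),a,b)$ where $(F_N)$ is a F\o lner sequence in $G$ and $a:G\to\mathbb{R}_{\ge0}$, $b:\mathbb{N}\to\mathbb{R}_{\ge0}$ satisfy $\frac{1}{b(N)|F_N|}\sum_{g\in F_N}a(g)\to1$ as $N\to\infty$. A family $\{f_1,\dots,f_\ell\}$ of functions $f_i:G\to\mathbb{D}$ is accordant with $((F_N),a,b)$ if for all $r\in\mathbb{N}$, $g_1,\dots,g_r\in G$ and any choice of $\tilde f_i\in\{f_1,\dots,f_\ell,\bar f_1,\dots,\bar f_\ell\}$ the limit $\lim_{N\to\infty}\frac{1}{b(N)|F_N|}\sum_{g\in F_N}a(g)\prod_{i=1}^r\tilde f_i(g_ig)$ exists. Given such an accordant family, a standard measure preserving system $(X,\mathcal{B},\mu,(T_g)_{g\in G})$ is a Furstenberg system for the tuple $(\{f_1,\dots,f_\ell\},(F_N),a,b)$ if there are $F_1,\dots,F_\ell\in L^\infty(\mu)$ such that for all $r\in\mathbb{N}$, $g_1,\dots,g_r\in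 G$ and any simultaneous choice of $\tilde f_i\in\{f_1,\dots,f_\ell,\bar f_1,\dots,\bar f_\ell\}$ and the corresponding $\tilde F_i\in\{F_1,\dots,F_\ell,\bar F_1,\dots,\bar F_\ell\}$ ($\tilde F_i=F_j$ when $\tilde f_i=f_j$, $\tilde F_i=\bar F_j$ when $\tilde f_i=\bar f_j$) one has $\lim_{N\to\infty}\frac{1}{b(N)|F_N|}\sum_{g\in F_N}a(g)\prod_{i=1}^r\tilde f_i(g_ig)=\int_XT_{g_1}\tilde F_1\cdots T_{g_r}\tilde F_r\,d\mu$, and moreover $\mathcal{B}$ is the completion of the $G$-invariant $\sigma$-algebra generated by $F_1,\dots,F_\ell$. Two systems $(X,\mathcal{B},\mu,(T_g)_{g\in G})$ and $(Y,\mathcal{C},\nu,(S_g)_{g\in G})$ are isomorphic if there are full-measure measurable sets $X'\subseteq X$, $Y'\subseteq Y$ with $T_gX'\subseteq X'$, $S_gY'\subseteq Y'$ for all $g$, and a bimeasurable measure preserving bijection $\varphi:X'\to Y'$ with $\varphi(T_gx)=S_g\varphi(x)$ for all $x\in X'$, $g\in G$. *)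

(* Defs.v *)
From HB Require Import structures.
From mathcomp Require Import all_boot all_order all_algebra finmap.
From mathcomp Require Import complex.
From mathcomp Require Import all_classical all_reals all_analysis.
From mathcomp Require Import measurable_realfun.

Set Implicit Arguments.
Unset Strict Implicit.
Unset Printing Implicit Defensive.

Import Order.TTheory GRing.Theory Num.Theory.
Import numFieldNormedType.Exports.

Local Open Scope classical_set_scope.
Local Open Scope ring_scope.
Local Open Scope complex_scope.

(* The topology of R[i] is found on its regular module R[i]^o. *)
Definition disk (R : realType) : Type :=
  set_type [set z : R[i]^o | `|z| <= 1].

HB.instance Definition _ (R : realType) := Topological.on (disk R).

Lemma disk0_subproof (R : realType) :
  (0 : R[i]^o) \in [set z : R[i]^o | `|z| <= 1].
Proof. by rewrite inE /= normr0 ler01. Qed.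

HB.instance Definition _ (R : realType) := isPointed.Build (disk R)
  (exist _ (0 : R[i]^o) (disk0_subproof R)).

Definition complex_of_disk (R : realType) (z : disk R) : R[i] := \val z.
Coercion complex_of_disk : disk >-> complex.

Definition maybe_conj (R : realType) (c : bool) (z : R[i]) : R[i] :=
  if c then z^* else z.

Definition folner (R : realType) (G : groupType) (F : nat -> {fset G}) : Prop :=
  (forall N, F N != fset0) /\
  forall g : G,
    let gF N := [fset (g * h)%g | h in F N]%fset in
    (fun N => #|` (F N `\` gF N) `|` (gF N `\` F N)|%fset%:R / #|` F N|%:R : R)
      @ \oo --> (0 : R).

Definition amenable (R : realType) (G : groupType) : Prop :=
  exists F : nat -> {fset G}, folner R F.

Definition averaging_scheme (R : realType) (G : groupType)
    (F : nat -> {fset G}) (a : G -> R) (b : nat -> R) : Prop :=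
  [/\ folner R F, forall g, 0 <= a g, forall N, 0 <= b N &
      (fun N => (b N * #|` F N|%:R)^-1 * \sum_(g <- F N) a g) @ \oo --> (1 : R)].

Definition average (R : realType) (G : groupType)
    (F : nat -> {fset G}) (a : G -> R) (b : nat -> R) (u : G -> R[i]) :
    nat -> R[i]^o :=
  fun N => ((b N * #|` F N|%:R)^-1)%:C * \sum_(g <- F N) (a g)%:C * u g.

(* A choice of the r functions among f_1, ..., f_l and their conjugates is
   given by indices j and by flags c saying which of them are conjugated. *)
Definition shifted_product (R : realType) (G : groupType) (l r : nat)
    (f : 'I_l -> G -> disk R) (gs : 'I_r -> G) (j : 'I_r -> 'I_l)
    (c : 'I_r -> bool) (g : G) : R[i] :=
  \prod_(i < r) maybe_conj (c i) (f (j i) (gs i * g)%g).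

Definition accordant (R : realType) (G : groupType) (l : nat)
    (f : 'I_l -> G -> disk R)
    (F : nat -> {fset G}) (a : G -> R) (b : nat -> R) : Prop :=
  forall (r : nat) (gs : 'I_r -> G) (j : 'I_r -> 'I_l) (c : 'I_r -> bool),
    cvg (average F a b (shifted_product f gs j c) @ \oo).

(* The completion of a probability space: its sigma-algebra consists of the
   sets A `|` N with A measurable and N negligible; this family is already a
   sigma-algebra, see completion_measurableE. *)
Definition completion_type (d : measure_display) (T : measurableType d)
    (R : realType) (mu : probability T R) : Type :=
  g_sigma_algebraType (completed_algebra_gen mu).

HB.instance Definition _ (d : measure_display) (T : measurableType d)
    (R : realType) (mu : probability T R) :=
  Measurable.on (completion_type mu).

(* The outer measure of mu, which extends mu. *)
Definition completion (d : measure_display) (T : measurableType d)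
    (R : realType) (mu : probability T R) : set (completion_type mu) -> \bar R :=
  (mu^*)%mu.

Arguments completion {d T R} mu A.

Lemma completion_cara (d : measure_display) (T : measurableType d)
    (R : realType) (mu : probability T R) (A : set (completion_type mu)) :
  measurable A -> ((mu^*)%mu).-cara.-measurable A.
Proof.
move: A; apply: smallest_sub.
  split.
  - exact: measurable0.
  - by move=> A mA; rewrite setTD; exact: measurableC.
  - by move=> A mA; exact: bigcupT_measurable.
move=> _ [A mA [N [B [mB B0 NB]]] <-].
apply: measurableU; first exact: caratheodory_measurable_mu_ext.
apply: (@measure_is_complete_caratheodory R _ (mu^*)%mu).
exists B; split => //; first exact: caratheodory_measurable_mu_ext.
exact: (etrans (measurable_mu_extE mu mB) B0).
Qed.

Lemma completion0 (d : measure_display) (T : measurableType d)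
    (R : realType) (mu : probability T R) : completion mu set0 = 0%E.
Proof. exact: outer_measure0. Qed.

Lemma completion_ge0 (d : measure_display) (T : measurableType d)
    (R : realType) (mu : probability T R) (A : set (completion_type mu)) :
  (0 <= completion mu A)%E.
Proof. exact: outer_measure_ge0. Qed.

Lemma completion_sigma_additive (d : measure_display) (T : measurableType d)
    (R : realType) (mu : probability T R) :
  semi_sigma_additive (completion mu).
Proof.
move=> A mA tA mUA.
apply: (@caratheodory_measure_sigma_additive R T (mu^*)%mu A) => //.
- by move=> i; exact: completion_cara.
- exact: completion_cara.
Qed.

HB.instance Definition _ (d : measure_display) (T : measurableType d)
    (R : realType) (mu : probability T R) :=
  isMeasure.Build _ _ _ (completion mu) (@completion0 d T R mu)
    (@completion_ge0 d T R mu) (@completion_sigma_additive d T R mu).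

Lemma completionE (d : measure_display) (T : measurableType d)
    (R : realType) (mu : probability T R) (A : set T) :
  measurable A -> completion mu A = mu A.
Proof. exact: measurable_mu_extE. Qed.

Lemma completion_setT (d : measure_display) (T : measurableType d)
    (R : realType) (mu : probability T R) : completion mu setT = 1%E.
Proof. by rewrite completionE// probability_setT. Qed.

HB.instance Definition _ (d : measure_display) (T : measurableType d)
    (R : realType) (mu : probability T R) :=
  Measure_isProbability.Build _ _ _ (completion mu) (completion_setT mu).

Lemma completion_measurableE (d : measure_display) (T : measurableType d)
    (R : realType) (mu : probability T R) :
  (measurable : set (set (completion_type mu))) = completed_algebra_gen mu.
Proof.
apply: sigma_algebra_id; split.
- by exists set0 => //; exists set0; [exact: negligible_set0|rewrite setU0].
- move=> _ [A mA [N [B [mB B0 NB]] <-]].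
  exists (~` A `&` ~` B).
    by apply: measurableI; exact: measurableC.
  exists (B `&` ~` A `&` ~` N).
    by exists B; split => // x [[]].
  apply/seteqP; split => x /=.
    case=> [[nA nB]|[[Bx nA] nN]]; split=> //; last by case.
    by case=> // /NB.
  case=> _ /not_orP[nA nN].
  by have [Bx|nB] := pselect (B x); [right|left].
- move=> C mC.
  have /choice[A /choice[N AN]] n : exists A N,
      [/\ measurable A, mu.-negligible N & A `|` N = C n].
    by case: (mC n) => A mA [N nN CE]; exists A, N.
  exists (\bigcup_n A n).
    by apply: bigcupT_measurable => n; case: (AN n).
  exists (\bigcup_n N n).
    by apply: negligible_bigcup => n; case: (AN n).
  by rewrite -bigcupU; apply: eq_bigcup => // n _; case: (AN n).
Qed.

(* phi restricts to an isomorphism of measure spaces X' -> Y' between subsets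
   of full measure; its values off X' are irrelevant. *)
Definition iso_mod0 (d d' : measure_display) (X : measurableType d)
    (Y : measurableType d') (R : realType)
    (mu : probability X R) (nu : probability Y R)
    (X' : set X) (Y' : set Y) (phi : X -> Y) : Prop :=
  [/\ measurable X' /\ mu X' = 1%E,
      measurable Y' /\ nu Y' = 1%E,
      set_bij X' Y' phi,
      forall A, measurable A -> A `<=` X' -> measurable (phi @` A) &
      forall B, measurable B -> B `<=` Y' ->
        measurable (X' `&` phi @^-1` B) /\ mu (X' `&` phi @^-1` B) = nu B].

(* Lebesgue space: complete, and isomorphic mod 0 to an interval [0, s] with
   Lebesgue measure together with at most countably many atoms, of masses p n;
   the atoms are placed at the points -1, -2, ... of the real line. *)
Definition lebesgue_space (d : measure_display) (X : measurableType d)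
    (R : realType) (mu : probability X R) : Prop :=
  measure_is_complete mu /\
  exists (s : R) (p : nat -> R) (P : probability (measurableTypeR R) R),
    [/\ 0 <= s, forall n, 0 <= p n,
        forall A : set R, measurable A ->
          P A = (lebesgue_measure (A `&` `[0%R, s]%classic) +
                 \sum_(0 <= n <oo) (p n)%:E * \d_(- n.+1%:R : R)%R A)%E &
        exists (X' : set X) (Y' : set (completion_type P))
               (phi : X -> completion_type P),
          iso_mod0 mu (completion P) X' Y' phi].

Definition measure_preserving_action (G : groupType) (d : measure_display)
    (X : measurableType d) (R : realType) (mu : probability X R)
    (T : G -> X -> X) : Prop :=
  [/\ forall x, T 1%g x = x,
      forall g h x, T (g * h)%g x = T g (T h x),
      forall g, measurable_fun setT (T g) &
      forall g A, measurable A -> mu (T g @^-1` A) = mu A].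

Definition standard_system (G : groupType) (d : measure_display)
    (X : measurableType d) (R : realType) (mu : probability X R)
    (T : G -> X -> X) : Prop :=
  lebesgue_space mu /\ measure_preserving_action mu T.

Definition isomorphic_systems (G : groupType) (d d' : measure_display)
    (X : measurableType d) (Y : measurableType d') (R : realType)
    (mu : probability X R) (T : G -> X -> X)
    (nu : probability Y R) (S : G -> Y -> Y) : Prop :=
  exists (X' : set X) (Y' : set Y) (phi : X -> Y),
    [/\ iso_mod0 mu nu X' Y' phi,
        forall g x, X' x -> X' (T g x),
        forall g y, Y' y -> Y' (S g y) &
        forall g x, X' x -> phi (T g x) = S g (phi x)].

Definition Linfty (d : measure_display) (X : measurableType d) (R : realType)
    (mu : probability X R) (F : X -> R[i]) : Prop :=
  (forall O : set R[i]^o, open O -> measurable (F @^-1` O)) /\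
  exists M : R, {ae mu, forall x, `|F x| <= M%:C}.

Definition Cintegral (d : measure_display) (X : measurableType d)
    (R : realType) (mu : probability X R) (F : X -> R[i]) : R[i] :=
  (\int[mu]_x complex.Re (F x)) +i* (\int[mu]_x complex.Im (F x)).

(* The smallest sigma-algebra that is stable under the preimages by the T g
   and makes all the Fs j measurable. *)
Definition invariant_sigma_algebra (G : groupType) (X : Type) (R : realType)
    (T : G -> X -> X) (l : nat) (Fs : 'I_l -> X -> R[i]) : set (set X) :=
  smallest
    [set S | sigma_algebra setT S /\ forall g A, S A -> S (T g @^-1` A)]
    [set A | exists j (O : set R[i]^o), open O /\ A = Fs j @^-1` O].

(* The elements of L^oo(mu) are only defined up to null sets, so the completion
   of the sigma-algebra they generate is taken with respect to all the null
   sets of mu, which makes it independent of the representatives Fs. *)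
Definition furstenberg_system (R : realType) (G : groupType) (l : nat)
    (f : 'I_l -> G -> disk R)
    (F : nat -> {fset G}) (a : G -> R) (b : nat -> R)
    (d : measure_display) (X : measurableType d) (mu : probability X R)
    (T : G -> X -> X) : Prop :=
  standard_system mu T /\
  exists Fs : 'I_l -> X -> R[i],
    [/\ forall j, Linfty mu (Fs j),
        forall (r : nat) (gs : 'I_r -> G) (j : 'I_r -> 'I_l)
               (c : 'I_r -> bool),
          average F a b (shifted_product f gs j c) @ \oo -->
          (Cintegral mu (fun x =>
             \prod_(i < r) maybe_conj (c i) (Fs (j i) (T (gs i) x))) : R[i]^o) &
        (measurable : set (set X)) =
          <<s invariant_sigma_algebra T Fs `|` mu.-negligible >>].

Definition shift_space (R : realType) (G : groupType) (l : nat) : Type :=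
  {ptws G -> {ptws 'I_l -> disk R}}.

HB.instance Definition _ (R : realType) (G : groupType) (l : nat) :=
  Topological.on (shift_space R G l).
HB.instance Definition _ (R : realType) (G : groupType) (l : nat) :=
  Pointed.on (shift_space R G l).

Definition shift_action (R : realType) (G : groupType) (l : nat) (g : G)
    (x : shift_space R G l) : shift_space R G l :=
  fun g0 => x (g0 * g)%g.

Definition orbit_point (R : realType) (G : groupType) (l : nat)
    (f : 'I_l -> G -> disk R) : shift_space R G l :=
  fun g i => f i g.

Notation borel_type Y := (g_sigma_algebraType (@open Y)).

(* nu is the weak* limit of the measures
   (b N * #|F N|)^-1 * \sum_(g in F N) a g * \d_(y g). *)
Definition weak_star_limit (R : realType) (G : groupType)
    (Y : ptopologicalType)
    (F : nat -> {fset G}) (a : G -> R) (b : nat -> R) (y : G -> Y)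
    (nu : probability (borel_type Y) R) : Prop :=
  forall h : Y -> R[i]^o, continuous h ->
    average F a b (fun g => h (y g)) @ \oo --> (Cintegral nu h : R[i]^o).

(* Main.v *)
Require Import Defs.
From HB Require Import structures.
From mathcomp Require Import all_boot all_order all_algebra finmap.
From mathcomp Require Import complex.
From mathcomp Require Import all_classical all_reals all_analysis.
From mathcomp Require Import measurable_realfun.
From mathcomp Require Import ring lra.

(** Let [F_j] be the functions on [X] that represent the [f_j]. The isomorphism
    is the map [factor_map] sending [x] to the family of the values
    [F_j (T_g x)], indexed by [g] and [j]. It intertwines [T] with the shift,
    and almost everywhere these values lie in the disk, because all even moments
    of [`|F_j|] are limits of averages of powers of [`|f_j| <= 1] ([Fs_ae_le1]);
    the other values are replaced by 0.

    The image [factor_measure] of [mu] is the weak* limit. By the correlation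
    formula the averages along the orbit of [orbit_point f] converge to its integral for
    every monomial in the coordinates and their conjugates, hence, by
    [Stone_Weierstrass], for every continuous function
    ([weak_star_of_monomials]). A weak* limit is unique, since the integrals of
    continuous functions determine a Borel probability on a compact space with a
    countable separating family ([eq_borel_probability]). So every weak* limit
    is [factor_measure], and it remains to see that [factor_map] is an
    isomorphism onto its image after null sets are discarded.

    Injectivity: countably many measurable sets separate the points of a
    Lebesgue space, and since the sigma-algebra of [X] is generated by the
    [F_j (T_g x)] up to null sets ([measurable_mod_negligible]), each of these
    sets is a preimage from the shift space up to a null set. Removing the
    countably many translates of the null sets leaves an invariant set of full measure on
    which the map is injective ([factor_injective]).

    Measurability of images: in a Lebesgue space Lusin's theorem shows that the
    image of a measurable set [A] contains a Borel set whose preimage has measure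
    at least [mu A] ([lebesgue_space_image]). For an injective map the same
    applies to the complement, so the image of [A] lies between two Borel sets of
    equal measure and is measurable in the completion ([factor_isomorphism]). *)

Set Implicit Arguments.
Unset Strict Implicit.
Unset Printing Implicit Defensive.

Import Order.TTheory GRing.Theory Num.Theory.
Import numFieldNormedType.Exports.

Local Open Scope classical_set_scope.
Local Open Scope ring_scope.

(** * Stone-Weierstrass *)

(** The families of all sets above a member of [P] form a filter base on
    [set Y], along which each point has a neighbourhood that is eventually
    covered; compactness makes this covering uniform. *)
Lemma compact_induction (Y : topologicalType) (P : set Y -> Prop) :
  compact [set: Y] -> P set0 ->
  (forall U V, P U -> P V -> P (U `|` V)) ->
  (forall y : Y, exists2 U, nbhs y U & P U) ->
  P setT.
Proof.
move=> /compact_near_coveringP cY P0 PU Pnbhs.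
pose F : set_system (set Y) := [set S | exists2 U, P U & forall V, U `<=` V -> S V].
have FF : Filter F.
  split; first by exists set0.
    move=> S T [U PU' US] [V PV VT]; exists (U `|` V); first exact: PU.
    by move=> W UVW; split; [apply: US|apply: VT] => y; move=> ?; apply: UVW;
      [left|right].
  by move=> S T ST [U PU' US]; exists U => // V /US /ST.
have [|U PU' US] := cY _ F (fun U y => U y) FF.
  move=> y _; have [U yU PU'] := Pnbhs y.
  exists (U, [set V | U `<=` V]); first by split => //; exists U.
  by move=> [z V] /= [Uz]; exact.
rewrite (_ : setT = U)//; apply/seteqP; split => //; exact: US.
Qed.

Lemma continuous_bounded (R : realType) (Y : topologicalType) (g : Y -> R) :
  compact [set: Y] -> continuous g ->
  exists2 M, 0 < M & forall y, `|g y| <= M.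
Proof.
move=> cY cg.
suff : exists2 M, 0 < M & forall y, [set: Y] y -> `|g y| <= M.
  by move=> [M M0 TM]; exists M => // y; exact: TM.
apply: (@compact_induction Y
  (fun U => exists2 M, 0 < M & forall y, U y -> `|g y| <= M)) => //.
- by exists 1.
- move=> U V [M M0 UM] [N N0 VN]; exists (M + N); first exact: addr_gt0.
  move=> y [/UM|/VN] /le_trans; apply; first by rewrite lerDl ltW.
  by rewrite lerDr ltW.
- move=> y; exists [set z | `|g z| <= `|g y| + 1]; last first.
    by exists (`|g y| + 1) => //; rewrite ltr_wpDl.
  have : g @ y --> g y by exact: cg.
  move=> /cvgrPdist_le/(_ _ ltr01); apply: filterS => z yz /=.
  rewrite -[g z](subrK (g y)) addrC; apply: (le_trans (ler_normD _ _)).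
  by rewrite lerD2l distrC.
Qed.

Section StoneWeierstrass.
Context {R : realType} {Y : topologicalType}.
Implicit Types (A : set (Y -> R)) (f g h : Y -> R).

Record function_algebra A : Prop := {
  fa_cst : forall c, A (cst c);
  fa_add : forall f g, A f -> A g -> A (fun y => f y + g y);
  fa_mul : forall f g, A f -> A g -> A (fun y => f y * g y);
  fa_cts : forall f, A f -> continuous f }.

Definition uniform_closure A : set (Y -> R) :=
  [set f | continuous f /\
    forall e, 0 < e -> exists2 g, A g & forall y, `|f y - g y| <= e].

(** The Newton iteration for the square root of [t ^+ 2], started at 0: it
    approximates [`|t|] on [[-1, 1]] by polynomials in [t ^+ 2]. *)
Fixpoint abs_approx (n : nat) (t : R) : R :=
  if n is m.+1 then abs_approx m t + (t ^+ 2 - abs_approx m t ^+ 2) / 2 else 0.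

(** The error [x] at one step becomes at most [x * (1 - x / 2)] at the next,
    which keeps it of order [2 / n]. *)
Lemma abs_approxP n t : `|t| <= 1 ->
  [/\ 0 <= abs_approx n t, abs_approx n t <= `|t| &
      n.+2%:R * (`|t| - abs_approx n t) <= 2].
Proof.
move=> t1; elim: n => [|n [p0 pt dn]] /=.
  by split => //; rewrite subr0; lra.
have s0 : 0 <= `|t| by [].
rewrite -(real_normK (num_real t)).
move: s0 t1 p0 pt dn; set s := `|t|; set p := abs_approx n t => s0 t1 p0 pt dn.
have n0 : (0 : R) <= n%:R by [].
split; [nra|nra|].
move: dn; rewrite -[n.+3]addn3 -[n.+2]addn2 !natrD; move: (n%:R : R) n0 => k k0 dn.
have d1 : s - p <= 1 by lra.
have -> : s - (p + (s ^+ 2 - p ^+ 2) / 2) = (s - p) * (1 - (s + p) / 2) by field.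
have : (s - p) * (1 - (s + p) / 2) <= (s - p) * (1 - (s - p) / 2) by nra.
move: d1 dn; have : 0 <= s - p by lra.
move: (s - p) => d d0 d1 dn le; apply: (@le_trans _ _ ((k + 3) * (d * (1 - d / 2)))).
  by apply: ler_wpM2l => //; lra.
nra.
Qed.

Lemma uniform_closure_sub A : function_algebra A -> A `<=` uniform_closure A.
Proof.
move=> fA f Af; split; first exact: fa_cts Af.
by move=> e e0; exists f => // y; rewrite subrr normr0 ltW.
Qed.

Lemma uniform_closure_add A f g : function_algebra A ->
  uniform_closure A f -> uniform_closure A g ->
  uniform_closure A (fun y => f y + g y).
Proof.
move=> fA [cf Af] [cg Ag]; split.
  by move=> y; apply: cvgD; [exact: cf|exact: cg].
move=> e e0; have e20 : 0 < e / 2 by rewrite divr_gt0.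
have [f' Af' ff'] := Af _ e20; have [g' Ag' gg'] := Ag _ e20.
exists (fun y => f' y + g' y); first exact: fa_add.
move=> y; rewrite opprD addrACA (splitr e).
by apply: (le_trans (ler_normD _ _)); apply: lerD.
Qed.

Lemma uniform_closure_scale A c f : function_algebra A ->
  uniform_closure A f -> uniform_closure A (fun y => c * f y).
Proof.
move=> fA [cf Af]; split.
  by move=> y; apply: cvgM; [exact: cvg_cst|exact: cf].
move=> e e0; have c0 : 0 < `|c| + 1 by rewrite ltr_wpDl.
have [f' Af' ff'] := Af (e / (`|c| + 1)) (divr_gt0 e0 c0).
exists (fun y => c * f' y); first by apply: fa_mul => //; exact: fa_cst.
move=> y; rewrite -mulrBr normrM.
have /(ler_wpM2l (normr_ge0 c)) := ff' y; move/le_trans; apply.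
rewrite mulrCA -[leRHS]mulr1; apply: ler_wpM2l; first exact: ltW.
by rewrite ler_pdivrMr// mul1r lerDl.
Qed.

Lemma abs_approx_algebra A f n : function_algebra A -> A f ->
  A (fun y => abs_approx n (f y)).
Proof.
move=> fA Af; elim: n => [|n IHn] /=; first exact: fa_cst.
apply: fa_add => //.
rewrite (_ : (fun _ => _) = (fun y => (f y * f y +
   -1 * (abs_approx n (f y) * abs_approx n (f y))) * 2^-1)).
  apply: fa_mul => //; last exact: fa_cst.
  apply: fa_add => //; first exact: fa_mul.
  by apply: fa_mul; [|exact: fa_cst|exact: fa_mul].
by apply/funext => y; rewrite !expr2 mulN1r.
Qed.

Lemma uniform_closure_abs A f : compact [set: Y] -> function_algebra A ->
  uniform_closure A f -> uniform_closure A (fun y => `|f y|).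
Proof.
move=> cY fA [cf Af]; split.
  by move=> y; apply: cvg_norm; exact: cf.
move=> e e0; have e20 : 0 < e / 2 by rewrite divr_gt0.
have [g Ag fg] := Af _ e20.
have [M M0 gM] := continuous_bounded cY (fa_cts fA Ag).
have [n ne] : exists n : nat, M * 2 <= n%:R * (e / 2).
  exists (Num.Def.archi_bound (M * 2 / (e / 2))).
  by rewrite -ler_pdivrMr// ltW// archi_boundP// divr_ge0 ?mulr_ge0// ltW.
exists (fun y => M * abs_approx n (M^-1 * g y)).
  apply: fa_mul => //; first exact: fa_cst.
  by apply: abs_approx_algebra => //; apply: fa_mul => //; exact: fa_cst.
move=> y; have t1 : `|M^-1 * g y| <= 1.
  by rewrite normrM gtr0_norm ?invr_gt0// mulrC ler_pdivrMr// mul1r.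
have [p0 pt dn] := abs_approxP n t1.
have gE : `|g y| = M * `|M^-1 * g y|.
  by rewrite normrM gtr0_norm ?invr_gt0// mulrA divff ?mul1r// gt_eqF.
rewrite (_ : _ - _ = (`|f y| - `|g y|) +
  (`|g y| - M * abs_approx n (M^-1 * g y))); last ring.
apply: (le_trans (ler_normD _ _)); rewrite (splitr e); apply: lerD.
  exact: (le_trans (ler_dist_dist _ _) (fg y)).
rewrite gE -mulrBr normrM gtr0_norm// ger0_norm ?subr_ge0//.
move: p0 pt dn; move: (abs_approx _ _) => p; move: `|M^-1 * _| => s p0 pt dn.
have n0 : (0 : R) < n.+2%:R by [].
rewrite -(ler_pM2l n0) mulrCA.
apply: (@le_trans _ _ (M * 2)); first by rewrite ler_wpM2l ?(ltW M0).
apply: (le_trans ne); rewrite ler_wpM2r ?(ltW e20)// ler_nat.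
by rewrite -addn2 leq_addr.
Qed.

Lemma uniform_closure_max A f g : compact [set: Y] -> function_algebra A ->
  uniform_closure A f -> uniform_closure A g ->
  uniform_closure A (fun y => Num.max (f y) (g y)).
Proof.
move=> cY fA Af Ag.
rewrite (_ : (fun _ => _) = (fun y => 2^-1 * ((f y + g y) + `|f y + -1 * g y|))).
  apply: uniform_closure_scale => //; apply: uniform_closure_add => //.
    exact: uniform_closure_add.
  apply: uniform_closure_abs => //; apply: uniform_closure_add => //.
  exact: uniform_closure_scale.
by apply/funext => y; rewrite maxr_absE mulN1r mulrC.
Qed.

Lemma uniform_closure_min A f g : compact [set: Y] -> function_algebra A ->
  uniform_closure A f -> uniform_closure A g ->
  uniform_closure A (fun y => Num.min (f y) (g y)).
Proof.
move=> cY fA Af Ag.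
rewrite (_ : (fun _ => _) = (fun y => -1 * Num.max (-1 * f y) (-1 * g y))).
  apply: uniform_closure_scale => //.
  by apply: uniform_closure_max => //; exact: uniform_closure_scale.
by apply/funext => y; rewrite !mulN1r oppr_max !opprK.
Qed.

(** Interpolate [h] at pairs of points [x], [y] by members of the algebra. For
    fixed [x], a minimum of finitely many interpolants lies below [h + e] and
    still meets [h] at [x]; a maximum of finitely many such minima lies within
    [e] of [h]. *)
Theorem Stone_Weierstrass A h : compact [set: Y] -> function_algebra A ->
  (forall x y, x != y -> exists2 f, A f & f x != f y) ->
  continuous h -> uniform_closure A h.
Proof.
move=> cY fA sepA ch.
have interp x y : exists2 f, A f & f x = h x /\ f y = h y.
  have [<-|xy] := eqVneq x y; first by exists (cst (h x)) => //; exact: fa_cst.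
  have [f Af fxy] := sepA _ _ xy.
  have d0 : f y - f x != 0 by rewrite subr_eq0 eq_sym.
  exists (fun z => h x + (h y - h x) / (f y - f x) * (f z + - f x)).
    apply: fa_add => //; first exact: fa_cst.
    apply: fa_mul => //; first exact: fa_cst.
    by apply: fa_add => //; exact: fa_cst.
  split; first by rewrite subrr mulr0 addr0.
  by rewrite divfK// addrC subrK.
split => // e e0.
suff [f [cf Af] hf] : exists2 f, uniform_closure A f &
    forall z, `|h z - f z| <= e / 2.
  have [g Ag fg] := Af (e / 2) (divr_gt0 e0 (ltr0Sn _ 1)).
  exists g => // y; rewrite -(subrK (f y) (h y)) -addrA (splitr e).
  by apply: (le_trans (ler_normD _ _)); apply: lerD.
have {}e0 : 0 < e / 2 by rewrite divr_gt0.
move: (e / 2) e0 => {}e e0.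
have below x : exists2 f, uniform_closure A f &
    f x = h x /\ forall z, f z <= h z + e.
  suff : exists2 f, uniform_closure A f &
      f x = h x /\ forall z, [set: Y] z -> f z <= h z + e.
    by move=> [f Af [fx fh]]; exists f => //; split => // z; exact: fh.
  apply: (@compact_induction Y (fun U => exists2 f, uniform_closure A f &
      f x = h x /\ forall z, U z -> f z <= h z + e)) => //.
  - exists (cst (h x)); last by [].
    by apply: uniform_closure_sub => //; exact: fa_cst.
  - move=> U V [f Af [fx fU]] [g Ag [gx gV]].
    exists (fun z => Num.min (f z) (g z)); first exact: uniform_closure_min.
    split; first by rewrite fx gx minxx.
    by move=> z [/fU|/gV] H; rewrite ge_min H ?orbT.
  - move=> y; have [f Af [fx fy]] := interp x y.
    exists [set z | f z <= h z + e]; last first.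
      by exists f => //; exact: uniform_closure_sub.
    have : (fun z => f z - h z) @ y --> f y - h y.
      by apply: cvgB; [exact: (fa_cts fA Af)|exact: ch].
    rewrite fy subrr => /cvgrPdist_le/(_ _ e0).
    by apply: filterS => z /=; rewrite sub0r normrN ler_norml; lra.
have [[y0 _]|noY] := pselect (exists y : Y, True); last first.
  exists (cst 0); first by apply: uniform_closure_sub => //; exact: fa_cst.
  by move=> z; case: noY; exists z.
suff : exists2 f, uniform_closure A f & (forall z, f z <= h z + e) /\
    (forall z, [set: Y] z -> h z - e <= f z).
  move=> [f Af [fh hf]]; exists f => // z.
  by rewrite ler_norml; have := fh z; have := hf z I; lra.
apply: (@compact_induction Y (fun U => exists2 f, uniform_closure A f &
  (forall z, f z <= h z + e) /\ (forall z, U z -> h z - e <= f z))) => //.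
- by have [f Af [_ fh]] := below y0; exists f.
- move=> U V [f Af [fh fU]] [g Ag [gh gV]].
  exists (fun z => Num.max (f z) (g z)); first exact: uniform_closure_max.
  split; first by move=> z; rewrite ge_max fh gh.
  by move=> z [/fU|/gV] H; rewrite le_max H ?orbT.
- move=> y; have [f Af [fy fh]] := below y.
  exists [set z | h z - e <= f z]; last by exists f.
  have : (fun z => f z - h z) @ y --> f y - h y.
    by apply: cvgB; [exact: Af.1 y|exact: ch].
  rewrite fy subrr => /cvgrPdist_le/(_ _ e0).
  by apply: filterS => z /=; rewrite sub0r normrN ler_norml; lra.
Qed.

End StoneWeierstrass.

(** * Compact spaces with a countable separating family *)

Section SeparatingFamily.
Context {R : realType} {Y : ptopologicalType}.
Variables (u : nat -> Y -> R).
Hypotheses (cY : compact [set: Y]) (cu : forall k, continuous (u k))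
  (sepu : forall x y, x != y -> exists k, u k x != u k y).

(** The boolean chooses the side of the rational threshold. *)
Definition half_space (t : nat * bool * rat) : set Y :=
  [set y | if t.1.2 then ratr t.2 < u t.1.1 y else u t.1.1 y < ratr t.2].

Definition box (s : seq (nat * bool * rat)) : set Y :=
  [set y | forall t, t \in s -> half_space t y].

Lemma open_half_space t : open (half_space t).
Proof.
move: t => [[k [] ] q]; rewrite /half_space/=.
  exact: (@open_comp _ _ (u k) [set x | ratr q < x] (fun y _ => @cu k y)
    (@open_gt _ _)).
exact: (@open_comp _ _ (u k) [set x | x < ratr q] (fun y _ => @cu k y)
  (@open_lt _ _)).
Qed.

Lemma box_nil : box [::] = setT.
Proof. by apply/seteqP; split => // y _ t. Qed.

Lemma box_cons t s : box (t :: s) = half_space t `&` box s.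
Proof.
apply/seteqP; split => [y H|y [Ht Hs] t']; last by rewrite inE => /orP[/eqP->//|/Hs].
by split => [|t' t's]; apply: H; rewrite inE ?eqxx// t's orbT.
Qed.

Lemma box_cat s s' : box (s ++ s') = box s `&` box s'.
Proof.
elim: s => [|t s IHs]; first by rewrite box_nil setTI.
by rewrite cat_cons !box_cons IHs setIA.
Qed.

Lemma open_box s : open (box s).
Proof.
elim: s => [|t s IHs]; first by rewrite box_nil; exact: openT.
by rewrite box_cons; apply: openI => //; exact: open_half_space.
Qed.

(** If two points differ, a half-space around the first misses a neighbourhood
    of the second; by compactness the intersection of finitely many such
    half-spaces misses the complement of [O]. *)
Lemma box_basis (O : set Y) y : open O -> O y -> exists2 s, box s y & box s `<=` O.
Proof.
move=> oO Oy.
suff [s sy sO] : exists2 s, box s y & forall z, [set: Y] z -> box s z -> O z.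
  by exists s => // z; exact: sO.
apply: (@compact_induction Y
  (fun U => exists2 s, box s y & forall z, U z -> box s z -> O z)) => //.
- by exists [::] => //; rewrite box_nil.
- move=> U V [s sy sU] [s' s'y s'V]; exists (s ++ s'); rewrite box_cat//.
  by move=> z [/sU|/s'V] H [? ?]; exact: H.
- move=> z; have [Oz|nOz] := pselect (O z).
    by exists O; [exact: open_nbhs_nbhs|exists [::] => //; rewrite box_nil].
  have /sepu[k] : y != z by apply: contra_notN nOz => /eqP <-.
  rewrite neq_lt => /orP[yz|zy].
    have [q] := rat_in_itvoo yz; rewrite in_itv/= => /andP[yq qz].
    exists (half_space (k, true, q)).
      by apply: open_nbhs_nbhs; split => //; exact: open_half_space.
    exists [:: (k, false, q)]; first by rewrite box_cons box_nil setIT.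
    move=> x; rewrite box_cons box_nil setIT /half_space/= => /ltW + xq.
    by rewrite leNgt xq.
  have [q] := rat_in_itvoo zy; rewrite in_itv/= => /andP[zq qy].
  exists (half_space (k, false, q)).
    by apply: open_nbhs_nbhs; split => //; exact: open_half_space.
  exists [:: (k, true, q)]; first by rewrite box_cons box_nil setIT.
  move=> x; rewrite box_cons box_nil setIT /half_space/= => /ltW + xq.
  by rewrite leNgt xq.
Qed.

Lemma open_bigcup_box (O : set Y) : open O ->
  O = \bigcup_s (if `[< box s `<=` O >] then box s else set0).
Proof.
move=> oO; apply/seteqP; split => [y Oy|y [s _]]; last first.
  by case: ifPn => // /asboolP; exact.
have [s sy sO] := box_basis oO Oy.
by exists s => //; rewrite asboolT.
Qed.

Lemma separating_countable_base : exists V : nat -> set Y,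
  (forall n, open (V n)) /\
  forall y (O : set Y), open O -> O y -> exists2 n, V n y & V n `<=` O.
Proof.
exists (fun n => if choice.unpickle n is Some s then box s else set0); split.
  by move=> n; case: choice.unpickle => [s|]; [exact: open_box|exact: open0].
move=> y O oO Oy; have [s sy sO] := box_basis oO Oy.
by exists (choice.pickle s); rewrite choice.pickleK.
Qed.

Lemma separating_hausdorff : hausdorff_space Y.
Proof.
rewrite open_hausdorff => x y /sepu[k].
have H z z' : u k z < u k z' -> exists q, half_space (k, false, q) z /\
    half_space (k, true, q) z' /\
    half_space (k, false, q) `&` half_space (k, true, q) = set0.
  move=> zz'; have [q] := rat_in_itvoo zz'; rewrite in_itv/= => /andP[zq qz'].
  exists q; split => //; split => //; apply/seteqP; split => // w [].
  by rewrite /half_space/= => /ltW; rewrite leNgt => /negP.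
rewrite neq_lt => /orP[/H|/H] [q [Hz [Hz' H0]]].
  exists (half_space (k, false, q), half_space (k, true, q)) => /=; first by rewrite !inE.
  by split; [exact: open_half_space|exact: open_half_space|apply/eqP].
exists (half_space (k, true, q), half_space (k, false, q)) => /=; first by rewrite !inE.
by split; [exact: open_half_space|exact: open_half_space|apply/eqP; rewrite setIC].
Qed.

(** Every open set is a countable union of boxes. *)
Lemma separating_measurable d (X : measurableType d)
    (phi : X -> g_sigma_algebraType (@open Y)) :
  (forall k, measurable_fun setT (u k \o phi)) -> measurable_fun setT phi.
Proof.
move=> mu_phi; apply: (@measurability _ _ X (g_sigma_algebraType (@open Y))
  setT phi (@open Y) erefl)
  => _ [V oV <-].
rewrite setTI (open_bigcup_box oV) preimage_bigcup.
apply: countable_bigcupT_measurable => [|s]; first exact: countableP.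
case: ifPn => _; last by rewrite preimage_set0.
elim: s => [|[[k b] q] s IHs]; first by rewrite box_nil preimage_setT.
rewrite box_cons preimage_setI; apply: measurableI => //.
rewrite -[X in measurable X]setTI; case: b.
  rewrite (_ : _ @^-1` _ = (u k \o phi) @^-1` `]ratr q, +oo[%classic).
    exact: mu_phi.
  by apply/seteqP; split => x; rewrite /half_space/= in_itv/= andbT.
rewrite (_ : _ @^-1` _ = (u k \o phi) @^-1` `]-oo, ratr q[%classic).
  exact: mu_phi.
by apply/seteqP; split => x; rewrite /half_space/= in_itv.
Qed.

End SeparatingFamily.

Lemma continuous_borel_measurable (R : realType) (Y : ptopologicalType)
    (f : Y -> R) : continuous f ->
  measurable_fun (setT : set (g_sigma_algebraType (@open Y))) f.
Proof.
move=> cf; apply: (@measurability _ _ (g_sigma_algebraType (@open Y)) _ setT f _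
  (RGenOInfty.measurableE R)) => _ [_ [x ->] <-].
rewrite setTI; apply: sub_sigma_algebra.
by apply: open_comp; [move=> y _; exact: cf|exact: interval_open].
Qed.

Section CozeroSets.
Context {R : realType} {Y : ptopologicalType}.

Definition cozero : set (set Y) :=
  [set A | exists2 f : Y -> R, continuous f & A = [set y | 0 < f y]].

Lemma cozero_open A : cozero A -> open A.
Proof.
move=> [f cf ->]; exact: (@open_comp _ _ f [set x | 0 < x] (fun y _ => @cf y)
  (@open_gt _ _)).
Qed.

Lemma cozeroI : setI_closed cozero.
Proof.
move=> A B [f cf ->] [g cg ->]; exists (fun y => Num.min (f y) (g y)).
  by move=> y; apply: continuous_min; [exact: cf|exact: cg].
by apply/seteqP; split => y /=; rewrite lt_min => /andP.
Qed.

Lemma cozeroT : cozero setT.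
Proof.
exists (cst 1); first exact: cst_continuous.
by apply/seteqP; split => y //= _; exact: ltr01.
Qed.

(** The measure of a cozero set is the limit of the integrals of the functions
    [min 1 (n f)], which increase to its indicator function. *)
Lemma eq_measure_cozero (nu1 nu2 : probability (g_sigma_algebraType (@open Y)) R) :
  (forall f : Y -> R, continuous f ->
     (\int[nu1]_y f y)%R = (\int[nu2]_y f y)%R) ->
  forall A, cozero A -> nu1 A = nu2 A.
Proof.
move=> nu12 A [f cf ->].
pose g n y : R := Num.min 1 (n%:R * Num.max 0 (f y)).
have cg n : continuous (g n).
  move=> y; apply: (@continuous_min _ _ (cst 1)
    (fun y => n%:R * Num.max 0 (f y))); first exact: cst_continuous.
  apply: cvgM; first exact: cst_continuous.
  by apply: (@continuous_max _ _ (cst 0) f); [exact: cst_continuous|exact: cf].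
have g0 n y : 0 <= g n y.
  by rewrite le_min ler01 mulr_ge0// le_max lexx.
have g1 n y : g n y <= 1 by rewrite ge_min lexx.
have gnd y : {homo (fun n => g n y) : n m / (n <= m)%N >-> n <= m}.
  move=> n m nm; rewrite le_min ge_min lexx/= ge_min ler_wpM2r ?orbT//.
    by rewrite le_max lexx.
  by rewrite ler_nat.
have glim y : limn (fun n => (g n y)%:E) = (\1_[set y | 0 < f y] y)%:E :> \bar R.
  apply/cvg_lim => //; apply: cvg_EFin; first by near=> n.
  rewrite indicE; have [fy|fy] := ltP 0 (f y).
    rewrite mem_set//; apply: cvg_near_cst; near=> n.
    rewrite /= /g (max_idPr (ltW fy)); apply/min_idPl.
    rewrite -ler_pdivrMr// div1r; near: n; exact: nbhs_infty_ger.
  rewrite memNset/=; last by rewrite ltNge fy.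
  apply: cvg_near_cst; near=> n.
  by rewrite /= /g (max_idPl fy) mulr0 min_r.
have lim (nu : probability (g_sigma_algebraType (@open Y)) R) :
   (\int[nu]_y (g n y)%:E)%E @[n --> \oo] --> nu [set y | 0 < f y].
  rewrite -(setIT [set y | 0 < f y]) -integral_indic//; last first.
    by apply: sub_sigma_algebra; apply: cozero_open; exists f.
  under eq_integral do rewrite -glim.
  apply: cvg_monotone_convergence => //.
  - by move=> n; apply/measurable_EFinP; exact: continuous_borel_measurable.
  - by move=> n y _; rewrite lee_fin.
  - by move=> y _ n m nm; rewrite lee_fin; exact: gnd.
have fin (nu : probability (g_sigma_algebraType (@open Y)) R) n :
    (\int[nu]_y (g n y)%:E)%E \is a fin_num.
  rewrite ge0_fin_numE; last by apply: integral_ge0 => y _; rewrite lee_fin.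
  apply: (@le_lt_trans _ _ (\int[nu]_y (cst 1 y))%E); last first.
    rewrite integral_cst// mul1e.
    by apply: (le_lt_trans (probability_le1 nu measurableT)); rewrite ltry.
  apply: ge0_le_integral => //.
  - by move=> y _; rewrite lee_fin.
  - by apply/measurable_EFinP; exact: continuous_borel_measurable.
  - by move=> y _; rewrite lee_fin.
apply: cvg_unique (lim nu1) _ => //.
rewrite (_ : (fun n => _) = (fun n => (\int[nu2]_y (g n y)%:E)%E)); first exact: lim.
apply/funext => n; rewrite -(fineK (fin nu1 n)) -(fineK (fin nu2 n)).
by congr EFin; exact: nu12.
Unshelve. all: by end_near. Qed.

End CozeroSets.

(** The boxes are cozero sets and form a countable base, so the cozero sets are a
    pi-system that generates the Borel sets. *)
Lemma eq_borel_probability (R : realType) (Y : ptopologicalType)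
    (u : nat -> Y -> R) (cY : compact [set: Y])
    (cu : forall k, continuous (u k))
    (sepu : forall x y, x != y -> exists k, u k x != u k y)
    (nu1 nu2 : probability (g_sigma_algebraType (@open Y)) R) :
  (forall f : Y -> R, continuous f ->
     (\int[nu1]_y f y)%R = (\int[nu2]_y f y)%R) ->
  forall A, measurable A -> nu1 A = nu2 A.
Proof.
move=> nu12 A mA.
have boxE s : @cozero R Y (box u s).
  elim: s => [|t s IHs]; first by rewrite box_nil; exact: cozeroT.
  rewrite box_cons; apply: cozeroI => //; case: t => [[k b] q].
  exists (fun y => if b then u k y - ratr q else ratr q - u k y).
    case: b; move=> y; apply: cvgB; do ?exact: cvg_cst; exact: cu.
  by apply/seteqP; split => y; rewrite /half_space/=; case: b; rewrite subr_gt0.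
apply: (@g_sigma_algebra_measure_unique _ R (g_sigma_algebraType (@open Y))
  (@cozero R Y) _ (fun=> setT) _ _ nu1 nu2) => //.
- by move=> B /cozero_open oB; exact: sub_sigma_algebra.
- by move=> _; exact: cozeroT.
- by rewrite bigcup_const//; exists 0%N.
- exact: cozeroI.
- exact: eq_measure_cozero.
- by move=> k; apply: (le_lt_trans (probability_le1 nu1 measurableT)); rewrite ltry.
- move: A mA; apply: smallest_sub; first exact: smallest_sigma_algebra.
  move=> O oO; rewrite (open_bigcup_box cY cu sepu oO).
  apply: (@countable_bigcupT_measurable _ (g_sigma_algebraType (@cozero R Y))).
    exact: countableP.
  by move=> s; case: ifPn => _; [exact: sub_sigma_algebra|exact: measurable0].
Qed.

(** * Inner regularity of Lebesgue spaces *)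

Definition inner_regular (R : realType) (P : probability (measurableTypeR R) R) :=
  forall (A : set R) (e : R), measurable A -> 0 < e ->
    exists K : set R, [/\ compact K, K `<=` A & (P (A `\` K) <= e%:E)%E].

(** Approximate the continuous part from inside by a compact set, and keep
    finitely many atoms: the series of their masses has a small tail. *)
Lemma lebesgue_atoms_inner_regular (R : realType) (s : R) (p : nat -> R)
    (P : probability (measurableTypeR R) R) :
  (forall n, 0 <= p n) ->
  (forall A : set R, measurable A ->
     P A = (lebesgue_measure (A `&` `[0%R, s]%classic) +
            \sum_(0 <= n <oo) (p n)%:E * \d_(- n.+1%:R : R)%R A)%E) ->
  inner_regular P.
Proof.
move=> p0 PE A e mA e0.
have e20 : 0 < e / 2 by rewrite divr_gt0.
have mAs : measurable (A `&` `[0%R, s]%classic : set R) by exact: measurableI.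
have term0 (B : set R) n : (0 <= (p n)%:E * \d_(- n.+1%:R : R)%R B)%E.
  by rewrite mule_ge0// lee_fin.
have [K0 [cK0 K0A K0e]] : exists K : set R, [/\ compact K,
    K `<=` A `&` `[0%R, s]%classic &
    (lebesgue_measure ((A `&` `[0%R, s]%classic) `\` K) < (e / 2)%:E)%E].
  apply: lebesgue_regularity_inner => //.
  apply: (@le_lt_trans _ _ (P A)); first by rewrite PE// leeDl// nneseries_ge0.
  by apply: (le_lt_trans (probability_le1 P mA)); rewrite ltry.
pose f n := ((p n)%:E * \d_(- n.+1%:R : R)%R A)%E.
have [N fN] : exists N, (\sum_(N <= n <oo) f n < (e / 2)%:E)%E.
  have tail : (\sum_(N <= n <oo) f n)%E @[N --> \oo] --> 0%E.
    apply: nneseries_tail_cvg; last by move=> n _; exact: term0.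
    apply: (@le_lt_trans _ _ (P A)); first by rewrite PE// leeDr.
    by apply: (le_lt_trans (probability_le1 P mA)); rewrite ltry.
  have lt0 : nbhs (0 : \bar R)%E [set x | (x < (e / 2)%:E)%E].
    by apply: open_nbhs_nbhs; split; [exact: open_ereal_lt_ereal|rewrite /= lte_fin].
  have [N _ HN] := tail _ lt0.
  by exists N; exact: (HN N (leqnn N)).
pose K1 := A `&` [set (- n.+1%:R : R) | n in `I_N].
have fK1 : finite_set K1.
  apply: (@sub_finite_set _ _ [set (- n.+1%:R : R) | n in `I_N]); first by move=> x [].
  by apply: finite_image; exact: finite_II.
have cK : compact (K0 `|` K1) by apply: compactU => //; exact: finite_compact.
have mK : measurable (K0 `|` K1 : set R) by exact: compact_measurable.
exists (K0 `|` K1); split => //.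
  by move=> x [/K0A[]|[]].
rewrite PE; last exact: measurableD.
rewrite (splitr e) EFinD; apply: leeD.
  apply: (le_trans _ (ltW K0e)); apply: le_measure; rewrite ?inE.
  - by apply: measurableI => //; exact: measurableD.
  - by apply: measurableD => //; exact: compact_measurable.
  - by move=> x [[Ax nK] sx]; split => // K0x; apply: nK; left.
apply: (le_trans _ (ltW fN)).
rewrite (nneseries_split 0 N)// add0n big1_seq ?add0e; last first.
  move=> n /=; rewrite mem_index_iota => nN; rewrite diracE memNset ?mule0//.
  by move=> [Ax]; apply; right; split => //; exists n.
apply: lee_nneseries => [n _ _|n _]; first exact: term0.
apply: lee_wpmul2l; first by rewrite lee_fin.
rewrite !diracE lee_fin ler_nat.
by case: (boolP (_ \in _ `\` _)) => // /[!inE] -[Ax _]; rewrite mem_set.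
Qed.

(** Choose compact subsets of the preimage of each basic open set and of its
    complement, up to summable errors: on the intersection of their unions the
    function is continuous. *)
Lemma Lusin_second_countable (R : realType) (P : probability (measurableTypeR R) R)
    (Y : topologicalType) (V : nat -> set Y) (A : set R)
    (B : nat -> set R) (theta : R -> Y) (e : R) :
  inner_regular P ->
  (forall y (O : set Y), open O -> O y -> exists2 n, V n y & V n `<=` O) ->
  measurable A -> (forall n, measurable (B n)) ->
  (forall n x, A x -> B n x <-> V n (theta x)) -> 0 < e ->
  exists K : set R, [/\ compact K, K `<=` A, (P (A `\` K) <= e%:E)%E &
    {within K, continuous theta}].
Proof.
move=> regP baseV mA mB BV e0.
(* The error at [n] is split evenly between the two compact sets. *)
have en0 n : 0 < e / (2 ^ n.+1)%:R / 2 by rewrite !divr_gt0// ltr0n expn_gt0.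
have /choice[C CP] n : exists K, [/\ compact K, K `<=` A `&` B n &
    (P ((A `&` B n) `\` K) <= (e / (2 ^ n.+1)%:R / 2)%:E)%E].
  by apply: regP => //; exact: measurableI.
have /choice[D DP] n : exists K, [/\ compact K, K `<=` A `\` B n &
    (P ((A `\` B n) `\` K) <= (e / (2 ^ n.+1)%:R / 2)%:E)%E].
  by apply: regP => //; exact: measurableD.
have hR : hausdorff_space R by exact: norm_hausdorff.
have mC n : measurable (C n) by case: (CP n) => cC _ _; exact: compact_measurable.
have mD n : measurable (D n) by case: (DP n) => cD _ _; exact: compact_measurable.
have cCD n : compact (C n `|` D n).
  by apply: compactU; [case: (CP n)|case: (DP n)].
have clCD n : closed (C n `|` D n) by exact: compact_closed.
pose K := \bigcap_n (C n `|` D n).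
have KA : K `<=` A.
  move=> x /(_ 0%N I) [|]; first by case: (CP 0%N) => _ H _ /H [].
  by case: (DP 0%N) => _ H _ /H [].
exists K; split => //.
- apply: (subclosed_compact _ (cCD 0%N)); last by move=> x; exact.
  by apply: closed_bigI => n _.
- have mK : measurable K by apply: bigcapT_measurable => n; exact: measurableU.
  apply: (le_trans _ (epsilon_trick0 predT (ltW e0))).
  apply: (@le_trans _ _ (\sum_(0 <= n <oo) P (A `\` (C n `|` D n)))%E).
    apply: measure_sigma_subadditive.
    - move=> n; apply: measurableD; first exact: mA.
      by apply: measurableU; [exact: mC|exact: mD].
    - by apply: measurableD; [exact: mA|exact: mK].
    - move=> x [Ax]; rewrite /K => /existsNP[n /not_implyP[_ nx]].
      by exists n.
  apply: lee_nneseries => // n _.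
  rewrite [X in (_ <= X%:E)%E](splitr (e / _)) EFinD.
  case: (CP n) => _ _ HC; case: (DP n) => _ _ HD.
  apply: (le_trans _ (leeD HC HD)).
  apply: (@le_trans _ _ (P ((A `&` B n `\` C n) `|` (A `\` B n `\` D n)))); last first.
    by apply: measureU2; (apply: measurableD; last by [exact: mC|exact: mD]);
      [apply: measurableI|apply: measurableD]; by [exact: mA|exact: mB].
  apply: le_measure; rewrite ?inE.
  + by apply: measurableD; [exact: mA|apply: measurableU; [exact: mC|exact: mD]].
  + by apply: measurableU; (apply: measurableD; last by [exact: mC|exact: mD]);
      [apply: measurableI|apply: measurableD]; by [exact: mA|exact: mB].
  + move=> x [Ax /not_orP[nC nD]]; have [Bx|nB] := pselect (B n x).
      by left.
    by right.
- apply/subspace_continuousP => x Kx W.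
  rewrite nbhsE => -[W' [oW' W'x] W'W].
  have [n Vx VW] := baseV _ _ oW' W'x.
  have Ax := KA _ Kx.
  have clD : closed (D n) by apply: compact_closed => //; case: (DP n).
  have nDx : ~ D n x.
    by case: (DP n) => _ H _ /H [_]; apply; apply/BV.
  have : nbhs x (~` D n) by apply: open_nbhs_nbhs; split => //; exact: closed_openC.
  apply: filterS => z nDz Kz; apply: W'W; apply: VW.
  have [Cz|//] := Kz n I.
  by case: (CP n) => _ /(_ _ Cz)[Az Bz] _; apply/BV.
Qed.

Section LebesgueSpace.
Context {R : realType} {d : measure_display} {X : measurableType d}
  {mu : probability X R}.
Hypothesis lX : lebesgue_space mu.

(** Rational half-lines of the model separate points. *)
Lemma lebesgue_space_separating : exists (X0 : set X) (A : nat -> set X),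
  [/\ measurable X0, mu X0 = 1%E, forall n, measurable (A n) &
      forall x x', X0 x -> X0 x' -> (forall n, A n x <-> A n x') -> x = x'].
Proof.
case: lX => _ [s [p [P [_ _ _ [X' [Y' [psi iso]]]]]]].
case: iso => -[mX' muX'] [mY' _] [psiXY psi_inj _] _ pre.
pose H n : set R := if choice.unpickle n is Some q then `]-oo, ratr q[%classic else set0.
exists X', (fun n => X' `&` psi @^-1` (Y' `&` H n)); split => //.
  move=> n; apply: (proj1 (pre _ _ _)); last by move=> ? [].
  apply: measurableI => //; rewrite completion_measurableE.
  exists (H n); last by exists set0; [exact: negligible_set0|rewrite setU0].
  by rewrite /H; case: choice.unpickle.
move=> x x' X'x X'x' AE; apply: psi_inj; rewrite ?inE//.
have sub z z' : X' z -> X' z' -> (forall n, (X' `&` psi @^-1` (Y' `&` H n)) z ->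
     (X' `&` psi @^-1` (Y' `&` H n)) z') -> ((psi z' : R) <= psi z)%R.
  move=> Xz Xz' zz'; rewrite leNgt; apply/negP => /rat_in_itvoo[q].
  rewrite in_itv/= => /andP[zq qz'].
  have [|_ [_]] := zz' (choice.pickle q).
    by split; [exact: Xz|split]; [exact: psiXY|rewrite /H choice.pickleK/= in_itv].
  by rewrite /H choice.pickleK/= in_itv/= ltNge (ltW qz').
by apply: (@le_anti _ R); apply/andP; split; apply: sub => // n /AE.
Qed.

(** Transport a measurable set to the model and apply Lusin there: a measurable
    function is continuous on compact sets that exhaust the given set, and
    these have closed images. *)
Lemma lebesgue_space_image (Y : ptopologicalType) (V : nat -> set Y)
    (phi : X -> g_sigma_algebraType (@open Y)) (A : set X) :
  hausdorff_space Y -> (forall n, open (V n)) ->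
  (forall y (O : set Y), open O -> O y -> exists2 n, V n y & V n `<=` O) ->
  measurable_fun setT phi -> measurable A ->
  exists E : set (g_sigma_algebraType (@open Y)),
    [/\ measurable E, E `<=` phi @` A & (mu A <= mu (phi @^-1` E))%E].
Proof.
move=> hY oV baseV mphi mA.
suff closed_image e : 0 < e -> exists E : set Y, [/\ closed E, E `<=` phi @` A &
    (mu A <= mu (phi @^-1` E) + e%:E)%E].
  have /choice[E EP] n : exists E : set Y, [/\ closed E, E `<=` phi @` A &
      (mu A <= mu (phi @^-1` E) + (n.+1%:R^-1)%:E)%E].
    by apply: closed_image; rewrite invr_gt0.
  have mE n : measurable (E n : set (g_sigma_algebraType (@open Y))).
    rewrite -(setCK (E n)); apply: measurableC; apply: sub_sigma_algebra.
    by apply: closed_openC; case: (EP n).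
  exists (\bigcup_n E n); split.
  - exact: bigcupT_measurable.
  - by move=> y [n _ Ey]; case: (EP n) => _ /(_ _ Ey).
  apply/lee_addgt0Pr => e e0.
  have [n ne] : exists n, (n.+1%:R^-1 <= e :> R).
    near \oo => n; exists n; apply: ltW; near: n.
    exact: near_infty_natSinv_lt (PosNum e0).
  case: (EP n) => _ _ /le_trans; apply; apply: leeD; last by rewrite lee_fin.
  apply: le_measure; rewrite ?inE.
  - by rewrite -(setTI (_ @^-1` _)); exact: mphi.
  - by rewrite -(setTI (_ @^-1` _)); apply: mphi => //; exact: bigcupT_measurable.
  - by move=> x Ex; exists n.
move=> e0.
case: lX => _ [s [p [P [s0 p0 PE [X' [Y' [psi iso]]]]]]].
have regP := lebesgue_atoms_inner_regular p0 PE.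
case: iso => -[mX' muX'] [mY' _] [psiXY psi_inj psi_surj] img pre.
(* [psi'] inverts the isomorphism [psi] onto the model. *)
have /choice[psi' psi'P] r : exists x, Y' r -> X' x /\ psi x = r.
  have [/psi_surj[x Xx <-]|nY] := pselect (Y' r); first by exists x.
  by exists point.
have psiK x : X' x -> psi' (psi x) = x.
  move=> Xx; have [X'x' E] := psi'P _ (psiXY _ Xx).
  by apply: psi_inj; rewrite ?inE.
have mphiV n : measurable (phi @^-1` V n).
  by rewrite -(setTI (_ @^-1` _)); apply: mphi => //; exact: sub_sigma_algebra.
have mA0 : measurable (A `&` X') by exact: measurableI.
have [B0 mB0 [N0 [M0 [mM0 M00 NM0]] BN0]] :
    completed_algebra_gen P (psi @` (A `&` X')).
  by rewrite -completion_measurableE; apply: img => // x [].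
have /choice[B BP] n : exists B, measurable B /\ exists N, P.-negligible N /\
    B `|` N = psi @` (A `&` X' `&` phi @^-1` V n).
  have : completed_algebra_gen P (psi @` (A `&` X' `&` phi @^-1` V n)).
    rewrite -completion_measurableE; apply: img; first exact: measurableI.
    by move=> x [[]].
  by move=> [B mB [N nN <-]]; exists B; split => //; exists N.
have /choice[N NP] n : exists N, [/\ measurable N, P N = 0%E &
    psi @` (A `&` X' `&` phi @^-1` V n) `\` B n `<=` N].
  have [_ [N [[M [mM M0' NM]] <-]]] := BP n.
  by exists M; split => // x [[]//] Nx _; exact: NM.
have mN n : measurable (N n) by case: (NP n).
have mUN : measurable (\bigcup_n N n) by exact: bigcupT_measurable.
have PUN : P (\bigcup_n N n) = 0%E.
  apply/eqP; rewrite eq_le measure_ge0 andbT.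
  apply: (le_trans (measure_sigma_subadditive _ mN mUN (@subset_refl _ _))).
  by rewrite eseries0// => n _ _; case: (NP n).
(* On the Borel set [A'], which fills [psi @` A] up to a null set, the
   preimages of the basic open sets under [theta] are traces of the Borel
   sets [B n]. *)
pose A' := B0 `\` \bigcup_n N n.
have mA' : measurable A' by exact: measurableD.
have A'A x : A' x -> (psi @` (A `&` X')) x by move=> [Bx _]; rewrite -BN0; left.
pose theta (r : R) : Y := phi (psi' r).
have [K [cK KA' PK ctheta]] : exists K : set R, [/\ compact K, K `<=` A',
    (P (A' `\` K) <= e%:E)%E & {within K, continuous theta}].
  apply: (@Lusin_second_countable R P Y V A' B theta e) => //.
    by move=> n; exact: (BP n).1.
  move=> n r A'r; have [x [Ax X'x] xr] := A'A _ A'r.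
  have [_ [N' [_ BN]]] := BP n; rewrite /theta -xr psiK//; split.
    move=> Br; have : (B n `|` N') (psi x) by left.
    rewrite BN => -[z [[Az X'z] /= Vz] zx].
    by rewrite -(psi_inj _ _ _ _ zx) ?inE.
  move=> Vx; apply: contrapT => nB; case: A'r => _; apply; exists n => //.
  by case: (NP n) => _ _; apply; rewrite -xr; split => //; exists x.
exists (theta @` K); split.
- by apply: compact_closed => //; exact: continuous_compact.
- move=> _ [r Kr <-]; have [x [Ax X'x] xr] := A'A _ (KA' _ Kr).
  by exists x => //; rewrite /theta -xr psiK.
have muP (C : set R) : measurable C -> C `<=` Y' ->
    measurable (X' `&` psi @^-1` C) /\ mu (X' `&` psi @^-1` C) = P C.
  move=> mC CY; rewrite -(completionE P mC); apply: pre => //.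
  rewrite completion_measurableE; exists C => //.
  by exists set0; [exact: negligible_set0|rewrite setU0].
have KY' : K `<=` Y'.
  by move=> r /KA' /A'A [x [_ X'x] <-]; exact: psiXY.
have mK : measurable (K : set R) by exact: compact_measurable.
have [mXK muXK] := muP K mK KY'.
have muA : mu A = P A'.
  transitivity (mu (A `&` X')).
    rewrite -[in LHS](setIT A) -(setUv X') setIUr measureU//; last 2 first.
    - by apply: measurableI => //; exact: measurableC.
    - by rewrite setIACA setICr setI0.
    rewrite [X in (_ + X)%E](_ : _ = 0%E) ?adde0//.
    apply/eqP; rewrite eq_le measure_ge0 andbT.
    apply: (@le_trans _ _ (mu (~` X'))).
      by apply: le_measure; rewrite ?inE//; [apply: measurableI => //|];
        exact: measurableC.
    by rewrite probability_setC// muX' subee.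
  have mim : measurable (psi @` (A `&` X') : set (completion_type P)).
    by apply: img => // x [].
  have AE : A `&` X' = X' `&` psi @^-1` (psi @` (A `&` X')).
    apply/seteqP; split => [x [Ax Xx]|x [Xx [z [Az Xz] zx]]].
      by split => //; exists x.
    by rewrite -(psi_inj _ _ _ _ zx) ?inE.
  rewrite AE (pre _ mim _).2; last by move=> _ [x [_ Xx] <-]; exact: psiXY.
  have A'E : psi @` (A `&` X') = A' `|` (N0 `|` (B0 `&` \bigcup_n N n)).
    rewrite -BN0 /A'; apply/seteqP; split => x /=.
      by have [|] := pselect ((\bigcup_n N n) x); tauto.
    by tauto.
  apply/eqP; rewrite eq_le; apply/andP; split; last first.
    by rewrite -(completionE P mA') le_outer_measure// A'E; left.
  apply: (@le_trans _ _ (P (A' `|` (M0 `|` \bigcup_n N n)))).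
    rewrite -(completionE P); last by do 2?apply: measurableU.
    apply: le_outer_measure; rewrite A'E => x.
    by move=> [|[/NM0|[_]]]; [left|right; left|right; right].
  apply: (le_trans (measureU2 _ _ _)) => //; first exact: measurableU.
  rewrite -[leRHS]adde0 leeD2l//.
  apply: (le_trans (measureU2 _ _ _)) => //.
  have le1 : (P M0 <= 0)%E by rewrite M00.
  have le2 : (P (\bigcup_n N n) <= 0)%E by rewrite PUN.
  by apply: (le_trans (leeD le1 le2)); rewrite adde0.
rewrite muA; apply: (@le_trans _ _ (P K + P (A' `\` K))%E).
  rewrite -[in leLHS](setUIDK A' K).
  apply: (le_trans (measureU2 _ _ _)) => //; [exact: measurableI|exact: measurableD|].
  by apply: leeD => //; apply: le_measure; rewrite ?inE//; exact: measurableI.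
apply: leeD => //; rewrite -muXK; apply: le_measure; rewrite ?inE//.
  rewrite -(setTI (_ @^-1` _)); apply: mphi => //.
  rewrite -(setCK (_ @` K)); apply: measurableC; apply: sub_sigma_algebra.
  by apply: closed_openC; apply: compact_closed => //; exact: continuous_compact.
by move=> x [Xx Kx]; exists (psi x) => //; rewrite /theta psiK.
Unshelve. all: by end_near. Qed.

End LebesgueSpace.

(** * The complex plane and the shift space *)

Section ComplexPlane.
Context {R : realType}.
Local Open Scope complex_scope.

Lemma normc_real (x : R) : `|x%:C| = `|x|%:C.
Proof. by rewrite normc_def/= expr0n addr0 sqrtr_sqr. Qed.

Lemma normc_i : `|'i : R[i]| = 1.
Proof. by rewrite normc_def/= expr0n expr1n add0r sqrtr1. Qed.

Lemma Re_le_norm (z : R[i]) (e : R) : `|z| <= e%:C -> `|complex.Re z| <= e.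
Proof. by move=> ze; rewrite -lecR (le_trans (normc_ge_Re z)). Qed.

Lemma Im_le_norm (z : R[i]) (e : R) : `|z| <= e%:C -> `|complex.Im z| <= e.
Proof.
move=> ze; rewrite -normrN -ReiNIm; apply: Re_le_norm.
by rewrite normrM normc_i mulr1.
Qed.

Lemma norm_le_ReIm (z : R[i]) (e e' : R) :
  `|complex.Re z| <= e -> `|complex.Im z| <= e' -> `|z| <= (e + e')%:C.
Proof.
move=> Re_e Im_e; rewrite {1}[z]complexE; apply: (le_trans (ler_normD _ _)).
by rewrite normrM normc_i mul1r !normc_real rmorphD/= lerD ?lecR.
Qed.

Lemma gt0_real_complex (e : R[i]) : 0 < e -> exists2 r : R, 0 < r & e = r%:C.
Proof.
rewrite ltcE/= => /andP[/eqP ie re]; exists (complex.Re e) => //.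
by apply/eqP; rewrite eq_complex/= -ie !eqxx.
Qed.

Lemma cvg_complexP T (F : set_system T) (FF : Filter F) (f : T -> R[i]^o)
    (z : R[i]^o) :
  f @ F --> z <-> ((fun t => complex.Re (f t)) @ F --> complex.Re z) /\
                  ((fun t => complex.Im (f t)) @ F --> complex.Im z).
Proof.
split=> [fz|[fRe fIm]].
  have near_f e : 0 < e -> \forall t \near F, `|z - f t| <= e%:C.
    by move=> e0; have /cvgrPdist_le := fz; apply; rewrite ltcR.
  split; apply/cvgrPdist_le => e /near_f; apply: filterS => t.
    by move=> /Re_le_norm; rewrite raddfB.
  by move=> /Im_le_norm; rewrite raddfB.
apply/cvgrPdist_le => e e0.
have [r r0 ->] := gt0_real_complex e0.
have r20 : 0 < r / 2 by rewrite divr_gt0.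
have /cvgrPdist_le/(_ _ r20) HRe := fRe.
have /cvgrPdist_le/(_ _ r20) HIm := fIm.
apply: filterS2 HRe HIm => t HRe HIm.
by rewrite (splitr r); apply: norm_le_ReIm; rewrite raddfB.
Qed.

Lemma continuous_complexP (Y : topologicalType) (h : Y -> R[i]^o) :
  continuous h <-> continuous (fun y => complex.Re (h y)) /\
                   continuous (fun y => complex.Im (h y)).
Proof.
split=> [ch|[cRe cIm] y]; last by apply/cvg_complexP; split; [exact: cRe|exact: cIm].
by split=> y; have /cvg_complexP[] := ch y.
Qed.

Lemma continuous_maybe_conj (Y : topologicalType) (c : bool) (h : Y -> R[i]^o) :
  continuous h -> continuous (fun y => maybe_conj c (h y) : R[i]^o).
Proof.
case: c => ch; last exact: ch.
have /continuous_complexP[cRe cIm] := ch; apply/continuous_complexP; split.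
  rewrite (_ : (fun _ => _) = (fun y => complex.Re (h y)))//.
  by apply/funext => y; case: (h y).
rewrite (_ : (fun _ => _) = (fun y => - complex.Im (h y))).
  by move=> y; apply: cvgN; exact: cIm.
by apply/funext => y; case: (h y).
Qed.

Lemma continuous_complexD (Y : topologicalType) (h k : Y -> R[i]^o) :
  continuous h -> continuous k -> continuous (fun x => h x + k x : R[i]^o).
Proof. by move=> ch ck x; apply: cvgD; [exact: ch|exact: ck]. Qed.

Lemma continuous_complexM (Y : topologicalType) (h k : Y -> R[i]^o) :
  continuous h -> continuous k -> continuous (fun x => h x * k x : R[i]^o).
Proof.
move=> /continuous_complexP[hR hI] /continuous_complexP[kR kI].
apply/continuous_complexP; split.
  rewrite (_ : (fun _ => _) = (fun x => complex.Re (h x) * complex.Re (k x) -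
      complex.Im (h x) * complex.Im (k x))).
    by move=> x; apply: cvgB; apply: cvgM;
      [exact: hR|exact: kR|exact: hI|exact: kI].
  by apply/funext => x; case: (h x) => ? ?; case: (k x).
rewrite (_ : (fun _ => _) = (fun x => complex.Re (h x) * complex.Im (k x) +
    complex.Im (h x) * complex.Re (k x))).
  by move=> x; apply: cvgD; apply: cvgM;
    [exact: hR|exact: kI|exact: hI|exact: kR].
by apply/funext => x; case: (h x) => ? ?; case: (k x).
Qed.

Lemma continuous_complex_prod (Y : topologicalType) (I : Type) (s : seq I)
    (h : I -> Y -> R[i]^o) : (forall i, continuous (h i)) ->
  continuous (fun y => \prod_(i <- s) h i y : R[i]^o).
Proof.
move=> ch; elim: s => [|i s IHs].
  by under eq_fun do rewrite big_nil; exact: cst_continuous.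
under eq_fun do rewrite big_cons.
exact: (continuous_complexM (ch i : continuous _) IHs).
Qed.

Lemma continuous_Re : continuous (fun z : R[i]^o => complex.Re z).
Proof. by have [] := (@continuous_complexP R[i]^o id).1 (fun=> cvg_id). Qed.

Lemma continuous_Im : continuous (fun z : R[i]^o => complex.Im z).
Proof. by have [] := (@continuous_complexP R[i]^o id).1 (fun=> cvg_id). Qed.

Lemma norm_le1E (z : R[i]) :
  (`|z| <= 1) = (complex.Re z ^+ 2 + complex.Im z ^+ 2 <= 1).
Proof.
by rewrite -(@expr_le1 _ 2)// -add_Re2_Im2 -[1]/(1%:C) lecR.
Qed.

Lemma closed_disk : closed [set z : R[i]^o | `|z| <= 1].
Proof.
have sum_squares (Y : topologicalType) (f g : Y -> R) : continuous f ->
    continuous g -> continuous (fun y => f y * f y + g y * g y).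
  move=> cf cg y; apply: cvgD; first by apply: cvgM; exact: cf.
  by apply: cvgM; exact: cg.
have cq := sum_squares _ _ _ continuous_Re continuous_Im.
rewrite (_ : mkset _ = (fun z : R[i]^o =>
    complex.Re z * complex.Re z + complex.Im z * complex.Im z) @^-1` [set x | x <= 1]).
  by apply: closed_comp; [move=> z _; exact: cq|exact: closed_le].
by apply/seteqP; split => z /=; rewrite norm_le1E !expr2.
Qed.

Lemma compact_disk : compact [set z : R[i]^o | `|z| <= 1].
Proof.
pose c (p : R * R) : R[i]^o := p.1 +i* p.2.
have cc : continuous c.
  by apply/continuous_complexP; split => p; [exact: cvg_fst|exact: cvg_snd].
apply: (@subclosed_compact _ _ (c @` (`[-1, 1]%classic `*` `[-1, 1]%classic))).
- exact: closed_disk.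
- apply: continuous_compact; first exact: continuous_subspaceT.
  by apply: compact_setX; exact: segment_compact.
- move=> z z1; exists (complex.Re z, complex.Im z); last by case: z {z1}.
  have {}z1 : `|z| <= 1%:C by [].
  by split; rewrite /= in_itv/= -ler_norml;
    [exact: Re_le_norm z1|exact: Im_le_norm z1].
Qed.

Lemma compact_set_type (X : topologicalType) (A : set X) :
  compact A -> compact [set: set_type A].
Proof.
move=> cA F FF _.
have FA : (\val @ F) A.
  by apply: (@filterS _ F _ setT) => [x _|]; [exact: set_valP|exact: filterT].
have [x [Ax clx]] := cA _ _ FA.
exists (exist _ x (mem_set Ax)); split => // B W FB [W' [[V oV <-] /= Vx] W'W].
have : (\val @ F) (\val @` B).
  by apply: (@filterS _ F _ B) => // b Bb; exists b.
have Vnbhs : nbhs x V by apply: open_nbhs_nbhs.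
move=> /clx/(_ Vnbhs) [_ [[b Bb <-] Vb]].
by exists b; split => //; apply: W'W.
Qed.

Lemma continuous_disk_val : continuous (fun z : disk R => (z : R[i]) : R[i]^o).
Proof. exact: initial_continuous. Qed.

End ComplexPlane.

Section ShiftSpace.
Context {R : realType} {G : groupType} {l : nat}.
Local Open Scope complex_scope.

Lemma compact_shift_space : compact [set: shift_space R G l].
Proof.
have cD : compact [set: disk R].
  by apply: compact_set_type; exact: compact_disk.
have cI : compact [set: {ptws 'I_l -> disk R}].
  rewrite (_ : setT = [set f | forall i, [set: disk R] (f i)]).
    exact: (@tychonoff 'I_l (fun=> disk R) (fun=> setT) (fun=> cD)).
  by apply/seteqP; split.
rewrite (_ : setT = [set f | forall i, [set: {ptws 'I_l -> disk R}] (f i)]).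
  exact: (@tychonoff G (fun=> {ptws 'I_l -> disk R}) (fun=> setT) (fun=> cI)).
by apply/seteqP; split.
Qed.

Lemma continuous_coordinate (g : G) (j : 'I_l) :
  continuous (fun x : shift_space R G l => (x g j : R[i]) : R[i]^o).
Proof.
move=> x; apply: continuous_comp; last exact: continuous_disk_val.
apply: (@continuous_comp _ _ _ (fun x : shift_space R G l => x g)
  (fun y : {ptws 'I_l -> disk R} => y j)).
  exact: (@proj_continuous G (fun=> {ptws 'I_l -> disk R}) g).
exact: (@proj_continuous 'I_l (fun=> disk R) j).
Qed.

(** The boolean selects the imaginary part. *)
Definition real_coordinate (t : G * 'I_l * bool) (x : shift_space R G l) : R :=
  let z : R[i] := x t.1.1 t.1.2 in if t.2 then complex.Im z else complex.Re z.

Lemma continuous_real_coordinate t : continuous (real_coordinate t).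
Proof.
have /continuous_complexP[cRe cIm] := @continuous_coordinate t.1.1 t.1.2.
by move: t cRe cIm => [[g j] []].
Qed.

Lemma real_coordinate_separates (x y : shift_space R G l) :
  x != y -> exists t, real_coordinate t x != real_coordinate t y.
Proof.
move=> /eqP xy; apply: contrapT => /forallNP H; apply: xy.
apply/funext => g; apply/funext => j; apply/val_inj.
apply/eqP; rewrite eq_complex; apply/andP; split; apply: contrapT => /negP.
  exact: (H (g, j, false)).
exact: (H (g, j, true)).
Qed.

(** Since [G] is countable, the coordinates can be listed; indices that list
    nothing get a constant. *)
Lemma countable_coordinates : countable [set: G] ->
  exists u : nat -> shift_space R G l -> R,
    [/\ forall k, continuous (u k),
        forall x y, x != y -> exists k, u k x != u k y &
        forall k, (exists t, u k = real_coordinate t) \/ u k = cst 0].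
Proof.
move=> /countable_injP[e einj].
pose code (t : G * 'I_l * bool) := choice.pickle (e t.1.1, t.1.2, t.2).
have code_inj : injective code.
  move=> [[g j] b] [[g' j'] b'] /(pcan_inj choice.pickleK) [eg -> ->].
  by rewrite (einj _ _ _ _ eg) ?inE.
have /choice[u uP] k : exists v : shift_space R G l -> R,
    (forall t, code t = k -> v = real_coordinate t) /\
    ((exists t, v = real_coordinate t) \/ v = cst 0).
  have [[t <-]|nt] := pselect (exists t, code t = k).
    by exists (real_coordinate t); split; [move=> t' /code_inj ->|left; exists t].
  by exists (cst 0); split; [move=> t tk; case: nt; exists t|right].
exists u; split.
- move=> k; have [_ [[t ->]|->]] := uP k; first exact: continuous_real_coordinate.
  exact: cst_continuous.
- move=> x y /real_coordinate_separates[t txy]; exists (code t).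
  by rewrite (proj1 (uP (code t)) t).
- by move=> k; case: (uP k).
Qed.

End ShiftSpace.

(** * Weak convergence of weighted averages *)

Section Averages.
Context {R : realType} {G : groupType}.
Variables (F : nat -> {fset G}) (a : G -> R) (b : nat -> R).
Hypothesis scheme : averaging_scheme F a b.
Local Open Scope complex_scope.

(** The average of the constant 1. *)
Definition mass N : R := (b N * #|` F N|%:R)^-1 * \sum_(g <- F N) a g.

Lemma averageD (u v : G -> R[i]) :
  average F a b (fun g => u g + v g) = (fun N => average F a b u N + average F a b v N).
Proof.
apply/funext => N; rewrite /average -mulrDr -big_split/=; congr (_ * _).
by apply: eq_bigr => g _; rewrite mulrDr.
Qed.

Lemma averageZ (c : R[i]) (u : G -> R[i]) :
  average F a b (fun g => c * u g) = (fun N => c * average F a b u N).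
Proof.
apply/funext => N; rewrite /average mulrCA; congr (_ * _).
by rewrite mulr_sumr; apply: eq_bigr => g _; rewrite mulrCA.
Qed.

Lemma average_bound (u : G -> R[i]) (C : R) N :
  (forall g, `|u g| <= C%:C) -> `|average F a b u N| <= (C * mass N)%:C.
Proof.
move=> uC; have [_ a0 b0 _] := scheme.
rewrite /average /mass normrM normc_real mulrCA rmorphM/=.
rewrite ger0_norm ?invr_ge0 ?mulr_ge0//; apply: ler_wpM2l.
  by rewrite lecR invr_ge0 mulr_ge0.
apply: (le_trans (ler_norm_sum _ _ _)); rewrite mulr_sumr rmorph_sum/=.
apply: ler_sum => g _; rewrite normrM normc_real (ger0_norm (a0 g)) rmorphM/= mulrC.
by apply: ler_wpM2r; [rewrite lecR|exact: uC].
Qed.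

Lemma cvg_mass : mass @ \oo --> (1 : R).
Proof. by have [] := scheme. Qed.

Lemma near_mass_le2 : \forall N \near \oo, mass N <= 2.
Proof.
have /cvgrPdist_le/(_ _ ltr01) := cvg_mass.
by apply: filterS => N; rewrite ler_norml; lra.
Qed.

End Averages.

Section ComplexIntegral.
Context {R : realType} {d : measure_display} {X : measurableType d}.
Variable mu : probability X R.
Local Open Scope complex_scope.

Definition Cintegrable (h : X -> R[i]) :=
  mu.-integrable setT (EFin \o (fun x => complex.Re (h x))) /\
  mu.-integrable setT (EFin \o (fun x => complex.Im (h x))).

Lemma CintegralD (h k : X -> R[i]) : Cintegrable h -> Cintegrable k ->
  Cintegral mu (fun x => h x + k x) = Cintegral mu h + Cintegral mu k.
Proof.
move=> [hR hI] [kR kI]; apply/eqP; rewrite eq_complex/=; apply/andP; split; apply/eqP.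
  by under eq_Rintegral do rewrite raddfD/=; rewrite RintegralD.
by under eq_Rintegral do rewrite raddfD/=; rewrite RintegralD.
Qed.

Lemma CintegralZ (c : R[i]) (h : X -> R[i]) : Cintegrable h ->
  Cintegral mu (fun x => c * h x) = c * Cintegral mu h.
Proof.
move=> [hR hI]; case: c => p q; apply/eqP; rewrite eq_complex/=.
have ReM z : complex.Re ((p +i* q) * z) = p * complex.Re z - q * complex.Im z.
  by case: z.
have ImM z : complex.Im ((p +i* q) * z) = p * complex.Im z + q * complex.Re z.
  by case: z.
have int r (f : X -> R) : mu.-integrable setT (EFin \o f) ->
    mu.-integrable setT (EFin \o (fun x => r * f x)).
  by move=> fi; apply: (eq_integrable _ (fun x => r%:E * (f x)%:E)%E) => //;
    exact: integrableZl.
apply/andP; split; apply/eqP.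
  under eq_Rintegral do rewrite ReM.
  by rewrite RintegralB//; [rewrite !RintegralZl|exact: int|exact: int].
under eq_Rintegral do rewrite ImM.
by rewrite RintegralD//; [rewrite !RintegralZl|exact: int|exact: int].
Qed.

Lemma Rintegral_probability_cst (C : R) : \int[mu]_x C = C.
Proof.
rewrite Rintegral_cst//.
have -> : (mu : measure X R) setT = 1%E by exact: probability_setT.
by rewrite mulr1.
Qed.

Lemma integrable_cst (C : R) : mu.-integrable setT (EFin \o cst C).
Proof.
exact: finite_measure_integrable_cst.
Qed.

Lemma Rintegral_bound (f : X -> R) (C : R) :
  mu.-integrable setT (EFin \o f) -> (forall x, `|f x| <= C) ->
  `|\int[mu]_x f x| <= C.
Proof.
move=> fi fC; apply: (le_trans (le_normr_Rintegral _ fi)) => //.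
rewrite -[leRHS]Rintegral_probability_cst.
by apply: le_Rintegral => //; [exact: integrable_norm|exact: integrable_cst].
Qed.

Lemma Cintegral_bound (h : X -> R[i]) (C : R) : Cintegrable h ->
  (forall x, `|h x| <= C%:C) -> `|Cintegral mu h| <= (C + C)%:C.
Proof.
move=> [hR hI] hC; apply: norm_le_ReIm => /=.
  by apply: Rintegral_bound => // x; exact: Re_le_norm.
by apply: Rintegral_bound => // x; exact: Im_le_norm.
Qed.

End ComplexIntegral.

Section WeakConvergence.
Context {R : realType} {G : groupType} {Y : ptopologicalType}.
Variables (F : nat -> {fset G}) (a : G -> R) (b : nat -> R).
Variables (y : G -> Y) (nu : probability (g_sigma_algebraType (@open Y)) R).
Hypotheses (scheme : averaging_scheme F a b) (cY : compact [set: Y]).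
Local Open Scope complex_scope.

Definition average_cvg (h : Y -> R[i]^o) :=
  average F a b (fun g => h (y g)) @ \oo --> (Cintegral nu h : R[i]^o).

Lemma continuous_integrable (f : Y -> R) :
  continuous f -> nu.-integrable setT (EFin \o f).
Proof.
move=> cf; have [M M0 fM] := continuous_bounded cY cf.
apply: measurable_bounded_integrable => //.
- by apply: (le_lt_trans (probability_le1 nu measurableT)); rewrite ltry.
- exact: continuous_borel_measurable.
- exists M; split; first exact: num_real.
  by move=> N MN x _ /=; exact: (le_trans (fM x) (ltW MN)).
Qed.

Lemma continuous_Cintegrable (h : Y -> R[i]^o) :
  continuous h -> Cintegrable nu h.
Proof.
by move=> /continuous_complexP[cR cI]; split; exact: continuous_integrable.
Qed.

Lemma average_cvgD (h k : Y -> R[i]^o) : continuous h -> continuous k ->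
  average_cvg h -> average_cvg k -> average_cvg (fun x => h x + k x).
Proof.
move=> ch ck hh kk; rewrite /average_cvg averageD CintegralD; last 2 first.
- exact: continuous_Cintegrable.
- exact: continuous_Cintegrable.
exact: (cvgD hh kk).
Qed.

Lemma average_cvgZ (c : R[i]) (h : Y -> R[i]^o) : continuous h ->
  average_cvg h -> average_cvg (fun x => c * h x).
Proof.
move=> ch hh; rewrite /average_cvg averageZ CintegralZ.
  exact: (cvgZl_tmp hh).
exact: continuous_Cintegrable.
Qed.

(** Averages and integrals are bounded by a multiple of the uniform norm, so
    convergence passes to uniform limits. *)
Lemma average_cvg_uniform (h : Y -> R[i]^o) : continuous h ->
  (forall e : R, 0 < e -> exists k : Y -> R[i]^o,
     [/\ continuous k, average_cvg k & forall x, `|h x - k x| <= e%:C]) ->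
  average_cvg h.
Proof.
move=> ch approx; apply/cvgrPdist_le => e e0.
have [r r0 ->] := gt0_real_complex e0.
(* The uniform error [r / 5] contributes twice to the integral, through its real
   and imaginary parts, and twice to the averages, whose masses are eventually
   at most 2; the fifth share is the error of the averages of [k]. *)
have r50 : 0 < r / 5 by rewrite divr_gt0.
have [k [ck kk hk]] := approx _ r50.
pose d (x : Y) : R[i]^o := h x + (-1) * k x.
have cd : continuous d.
  apply: continuous_complexD; first exact: ch.
  by apply: continuous_complexM; [exact: cst_continuous|exact: ck].
have dE x : d x = h x - k x by rewrite /d mulN1r.
have hE x : h x = d x + k x by rewrite dE subrK.
have -> : h = (fun x => d x + k x) by apply/funext.
rewrite averageD CintegralD; [|exact: continuous_Cintegrable..].
have r5C : 0 < (r / 5)%:C by rewrite ltcR.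
have /cvgrPdist_le/(_ _ r5C) kN := kk.
have mN := near_mass_le2 scheme.
apply: filterS2 kN mN => N kN mN.
rewrite opprD addrACA.
have dI : `|Cintegral nu d| <= (r / 5 + r / 5)%:C.
  apply: Cintegral_bound; first exact: continuous_Cintegrable.
  by move=> x; rewrite dE.
have dA : `|average F a b (fun g => d (y g)) N| <= (r / 5 * 2)%:C.
  apply: (@le_trans _ _ (r / 5 * mass F a b N)%:C).
    by apply: average_bound => // g; rewrite dE; exact: hk.
  by rewrite lecR ler_wpM2l// ltW.
have -> : r = (r / 5 + r / 5) + (r / 5 * 2) + r / 5 by field.
apply: (le_trans (ler_normD _ _)); rewrite rmorphD/=; apply: lerD => //.
by apply: (le_trans (ler_normB _ _)); rewrite rmorphD/=; apply: lerD.
Qed.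

Variables (K : Type) (coord : K -> Y -> R[i]^o) (conjK : K -> K).
Hypotheses (ccoord : forall k, continuous (coord k))
  (conjKE : forall k x, coord (conjK k) x = (coord k x)^*)
  (sep : forall x x', x != x' -> exists k, coord k x != coord k x')
  (mono_cvg : forall w : seq K, average_cvg (fun x => \prod_(k <- w) coord k x)).

(** The functions whose products with all monomials have convergent averages,
    and the multipliers of this class. The multipliers form an algebra that
    contains the coordinates, without any normal form for polynomials. *)
Let good (h : Y -> R[i]^o) := continuous h /\
  forall w : seq K, average_cvg (fun x => h x * \prod_(k <- w) coord k x).

Let multiplier (m : Y -> R[i]^o) := continuous m /\
  forall h, good h -> good (fun x => m x * h x).

Let continuous_mono w : continuous (fun x => \prod_(k <- w) coord k x : R[i]^o).
Proof. exact: (continuous_complex_prod (@ccoord)). Qed.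

Let multiplier_coord k : multiplier (coord k).
Proof.
split; first exact: ccoord.
move=> h [ch hh]; split; first exact: (continuous_complexM (@ccoord k) ch).
move=> w; have := hh (k :: w); congr average_cvg; apply/funext => x.
by rewrite big_cons mulrCA mulrA.
Qed.

Let multiplier_cst c : multiplier (cst c).
Proof.
split; first exact: cst_continuous.
move=> h [ch hh]; split; first exact: (continuous_complexM (@cst_continuous _ _ c) ch).
move=> w; under [X in average_cvg X]eq_fun do rewrite -mulrA.
apply: average_cvgZ; last exact: hh.
exact: (continuous_complexM ch (@continuous_mono w)).
Qed.

Let multiplierD m n : multiplier m -> multiplier n ->
  multiplier (fun x => m x + n x).
Proof.
move=> [cm mm] [cn nn]; split; first exact: (continuous_complexD cm cn).
move=> h gh; have [cmh mh] := mm _ gh; have [cnh nh] := nn _ gh.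
split; first by under eq_fun do rewrite mulrDl; exact: (continuous_complexD cmh cnh).
move=> w; under [X in average_cvg X]eq_fun do rewrite mulrDl mulrDl.
apply: average_cvgD; [|..|exact: mh|exact: nh].
  exact: (continuous_complexM cmh (@continuous_mono w)).
exact: (continuous_complexM cnh (@continuous_mono w)).
Qed.

Let multiplierM m n : multiplier m -> multiplier n ->
  multiplier (fun x => m x * n x).
Proof.
move=> [cm mm] [cn nn]; split; first exact: (continuous_complexM cm cn).
by move=> h /nn/mm; under [X in good X]eq_fun do rewrite mulrA.
Qed.

Let real_multiplier : set (Y -> R) :=
  [set f | multiplier (fun x => (f x)%:C)].

Let real_multiplier_algebra : function_algebra real_multiplier.
Proof.
split.
- by move=> c; exact: (multiplier_cst c%:C).
- move=> f g ff gg; have := multiplierD ff gg; congr multiplier.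
  by apply/funext => x; rewrite rmorphD.
- move=> f g ff gg; have := multiplierM ff gg; congr multiplier.
  by apply/funext => x; rewrite rmorphM.
- by move=> f [/continuous_complexP[]].
Qed.

Let real_multiplier_Re k : real_multiplier (fun x => complex.Re (coord k x)).
Proof.
rewrite /real_multiplier/=.
under eq_fun do rewrite ReJ_add mulrC -conjKE.
apply: multiplierM; first exact: multiplier_cst.
by apply: multiplierD; exact: multiplier_coord.
Qed.

Let real_multiplier_Im k : real_multiplier (fun x => complex.Im (coord k x)).
Proof.
rewrite /real_multiplier/=.
rewrite (_ : (fun _ => _) =
    (fun x => (- 'i / 2) * (coord k x + -1 * coord (conjK k) x))).
  apply: multiplierM; first exact: multiplier_cst.
  apply: multiplierD; first exact: multiplier_coord.
  by apply: multiplierM; [exact: multiplier_cst|exact: multiplier_coord].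
apply/funext => x; rewrite conjKE mulN1r; case: (coord k x) => p q.
apply/eqP; rewrite eq_complex; simpc; rewrite /=.
by rewrite andbT; apply/eqP; field.
Qed.

(** The real-valued multipliers form an algebra that separates points, so they
    are uniformly dense among the real continuous functions. *)
Theorem weak_star_of_monomials : weak_star_limit F a b y nu.
Proof.
have sepA x x' : x != x' -> exists2 f, real_multiplier f & f x != f x'.
  move=> /sep[k]; rewrite eq_complex negb_and => /orP[Rk|Ik].
    by exists (fun x => complex.Re (coord k x)) => //; exact: real_multiplier_Re.
  by exists (fun x => complex.Im (coord k x)) => //; exact: real_multiplier_Im.
have good1 : good (cst 1).
  split; first exact: cst_continuous.
  by move=> w; under [X in average_cvg X]eq_fun do rewrite mul1r; exact: mono_cvg.
have real_cvg (f : Y -> R) : continuous f -> average_cvg (fun x => (f x)%:C).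
  move=> cf; have [_ approx] := Stone_Weierstrass cY real_multiplier_algebra sepA cf.
  apply: average_cvg_uniform.
    by apply/continuous_complexP; split => //; exact: cst_continuous.
  move=> e /approx[g [cg gm] fg]; exists (fun x => (g x)%:C); split => //.
    have [_ /(_ [::])] := gm _ good1; congr average_cvg; apply/funext => x.
    by rewrite big_nil !mulr1.
  by move=> x; rewrite -rmorphB/= normc_real lecR.
move=> h /continuous_complexP[cR cI].
rewrite (_ : h = (fun x => (complex.Re (h x))%:C + 'i * (complex.Im (h x))%:C)).
  apply: average_cvgD.
  - by apply/continuous_complexP; split => //; exact: cst_continuous.
  - apply: continuous_complexM; first exact: cst_continuous.
    by apply/continuous_complexP; split => //; exact: cst_continuous.
  - exact: real_cvg.
  - apply: average_cvgZ; last exact: real_cvg.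
    by apply/continuous_complexP; split => //; exact: cst_continuous.
by apply/funext => x; exact: complexE.
Qed.

End WeakConvergence.

(** A weak* limit is determined by the integrals of continuous functions. *)
Lemma weak_star_limit_unique (R : realType) (G : groupType) (Y : ptopologicalType)
    (F : nat -> {fset G}) (a : G -> R) (b : nat -> R) (y : G -> Y)
    (nu1 nu2 : probability (g_sigma_algebraType (@open Y)) R)
    (u : nat -> Y -> R) (cY : compact [set: Y])
    (cu : forall k, continuous (u k))
    (sepu : forall x x', x != x' -> exists k, u k x != u k x') :
  weak_star_limit F a b y nu1 -> weak_star_limit F a b y nu2 ->
  forall A, measurable A -> nu1 A = nu2 A.
Proof.
move=> lim1 lim2; apply: (eq_borel_probability cY cu sepu) => f cf.
have cfC : continuous (fun x => (f x)%:C%C : R[i]^o).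
  by apply/continuous_complexP; split => //; exact: cst_continuous.
have E : Cintegral nu1 (fun x => (f x)%:C%C) = Cintegral nu2 (fun x => (f x)%:C%C).
  by apply: (cvg_unique (@norm_hausdorff _ R[i]^o) (lim1 _ cfC) (lim2 _ cfC)).
exact: (congr1 (fun z : R[i] => complex.Re z) E).
Qed.

(** * The factor map of a Furstenberg system *)

Lemma negligible_countable_bigcup (d : measure_display) (X : measurableType d)
    (R : realType) (mu : {measure set X -> \bar R}) (I : Type) (N : I -> set X) :
  countable [set: I] -> (forall i, mu.-negligible (N i)) ->
  mu.-negligible (\bigcup_i N i).
Proof.
move=> /countable_injP[e einj] nN.
have -> : \bigcup_i N i = \bigcup_n \bigcup_(i in [set i | e i = n]) N i.
  apply/seteqP; split => [x [i _ Nx]|x [n _ [i _ Nx]]]; last by exists i.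
  by exists (e i) => //; exists i.
apply: negligible_bigcup => n; have [[i <-]|ni] := pselect (exists i, e i = n).
  apply: (negligibleS _ (nN i)) => x [i' /= ii' Nx].
  by rewrite -(einj i' i) ?inE.
apply: (negligibleS _ (negligible_set0 mu)) => x [i /= ei _].
by case: ni; exists i.
Qed.

Lemma bernoulli_inequality (R : realType) (e : R) n :
  0 <= e -> 1 + n%:R * e <= (1 + e) ^+ n.
Proof.
move=> e0; elim: n => [|n IHn]; first by rewrite mul0r addr0 expr0.
rewrite exprS -natr1.
have n0 : (0 : R) <= n%:R by [].
apply: (@le_trans _ _ ((1 + e) * (1 + n%:R * e))); first by nra.
by apply: ler_wpM2l => //; lra.
Qed.

(** If [q] exceeded [1 + e] with positive probability, its moments would grow
    exponentially. *)
Lemma bounded_moments_ae_le1 (R : realType) (d : measure_display)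
    (X : measurableType d) (mu : probability X R) (q : X -> R) (M : R) :
  measurable_fun setT q -> (forall x, 0 <= q x) ->
  {ae mu, forall x, q x <= M} ->
  (forall r, (\int[mu]_x (q x ^+ r) <= 1)%R) ->
  mu.-negligible [set x | 1 < q x].
Proof.
move=> mq q0 qM mom.
have mqr r : measurable_fun setT (fun x => (q x ^+ r)%:E).
  by apply/measurable_EFinP; exact: measurable_funX.
have int_le r : (\int[mu]_x (q x ^+ r)%:E <= 1)%E.
  have fin : (\int[mu]_x (q x ^+ r)%:E)%E \is a fin_num.
    rewrite ge0_fin_numE; last by apply: integral_ge0 => x _; rewrite lee_fin exprn_ge0.
    have M0 : (0 : R) <= (Num.max 0 M) ^+ r by rewrite exprn_ge0// le_max lexx.
    apply: (@le_lt_trans _ _ (\int[mu]_x (cst ((Num.max 0 M) ^+ r)%:E x))%E).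
      apply: ae_ge0_le_integral => //.
      - by move=> x _; rewrite lee_fin exprn_ge0.
      apply: filterS qM => x qM _.
      by rewrite lee_fin lerXn2r ?nnegrE// ?le_max ?lexx// qM orbT.
    rewrite integral_cst//.
    have -> : (mu : measure X R) setT = 1%E by exact: probability_setT.
    by rewrite mule1 ltry.
  by rewrite -(fineK fin) lee_fin; exact: mom.
have mA n : measurable [set x | 1 + n.+1%:R^-1 <= q x].
  rewrite (_ : mkset _ = setT `&` q @^-1` `[1 + n.+1%:R^-1, +oo[%classic).
    exact: mq.
  by rewrite setTI; apply/seteqP; split => x /=; rewrite in_itv/= andbT.
rewrite (_ : mkset _ = \bigcup_n [set x | 1 + n.+1%:R^-1 <= q x]); last first.
  apply/seteqP; split => [x /= qx|x [n _ /=]]; last first.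
    by apply: lt_le_trans; rewrite ltrDl invr_gt0.
  have d0 : 0 < q x - 1 by rewrite subr_gt0.
  near \oo => n; exists n => //=.
  rewrite addrC -lerBrDr.
  by apply: ltW; near: n; exact: (near_infty_natSinv_lt (PosNum d0)).
apply: negligible_bigcup => n; apply/negligibleP => //.
apply: contrapT => /eqP A0.
set A := [set x | _] in mA A0 *; set e : R := n.+1%:R^-1 in mA A0.
have e0 : 0 < e by rewrite invr_gt0.
have Afin : mu A \is a fin_num.
  rewrite ge0_fin_numE//.
  by apply: (le_lt_trans (probability_le1 mu (mA n))); rewrite ltry.
have m0 : 0 < fine (mu A).
  by rewrite lt_neqAle eq_sym fine_eq0// A0 fine_ge0.
have mom_A r : (1 + e) ^+ r * fine (mu A) <= 1.
  rewrite -lee_fin EFinM fineK//.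
  apply: (le_trans _ (int_le r)).
  rewrite -integral_cst//; last exact: mA.
  apply: (@le_trans _ _ (\int[mu]_(x in A) (q x ^+ r)%:E)%E).
    apply: ge0_le_integral => //; try exact: mA.
    - by move=> x _; rewrite lee_fin exprn_ge0// addr_ge0// ltW.
    - exact: (measurable_funS measurableT (@subsetT _ _) (mqr r)).
    - move=> x Ax; rewrite lee_fin lerXn2r ?nnegrE//.
      by rewrite addr_ge0// ltW.
  apply: ge0_subset_integral => //; first exact: mA.
  by move=> x _; rewrite lee_fin exprn_ge0.
have [r re] : exists r : nat, 1 < r%:R * (e * fine (mu A)).
  exists (Num.Def.archi_bound (1 / (e * fine (mu A)))).
  by rewrite -ltr_pdivrMr ?mulr_gt0// archi_boundP// divr_ge0// ltW// mulr_gt0.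
have := mom_A r; rewrite leNgt => /negP; apply.
apply: (lt_le_trans re); rewrite mulrA; apply: ler_wpM2r; first exact: ltW.
apply: (le_trans _ (bernoulli_inequality _ (ltW e0))).
by rewrite lerDr.
Unshelve. all: by end_near. Qed.

Section ComplexMeasurable.
Context {R : realType} {d : measure_display} {X : measurableType d}.

Definition Cmeasurable (h : X -> R[i]%C) :=
  measurable_fun setT (fun x => complex.Re (h x)) /\
  measurable_fun setT (fun x => complex.Im (h x)).

Lemma CmeasurableM (h k : X -> R[i]%C) :
  Cmeasurable h -> Cmeasurable k -> Cmeasurable (fun x => h x * k x).
Proof.
move=> [hR hI] [kR kI]; split.
  rewrite (_ : (fun _ => _) = (fun x => complex.Re (h x) * complex.Re (k x) -
      complex.Im (h x) * complex.Im (k x))).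
    by apply: measurable_funB; exact: measurable_funM.
  by apply/funext => x; case: (h x) => ? ?; case: (k x).
rewrite (_ : (fun _ => _) = (fun x => complex.Re (h x) * complex.Im (k x) +
    complex.Im (h x) * complex.Re (k x))).
  by apply: measurable_funD; exact: measurable_funM.
by apply/funext => x; case: (h x) => ? ?; case: (k x).
Qed.

Lemma Cmeasurable_conj c (h : X -> R[i]%C) :
  Cmeasurable h -> Cmeasurable (fun x => maybe_conj c (h x)).
Proof.
case: c => //= -[hR hI]; split.
  rewrite (_ : (fun _ => _) = (fun x => complex.Re (h x)))//.
  by apply/funext => x; case: (h x).
rewrite (_ : (fun _ => _) = (fun x => - complex.Im (h x))).
  exact: measurableT_comp.
by apply/funext => x; case: (h x).
Qed.

Lemma Cmeasurable_prod (I : Type) (s : seq I) (h : I -> X -> R[i]%C) :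
  (forall i, Cmeasurable (h i)) -> Cmeasurable (fun x => \prod_(i <- s) h i x).
Proof.
move=> mh; elim: s => [|i s IHs].
  by under eq_fun do rewrite big_nil; split; exact: measurable_cst.
by under eq_fun do rewrite big_cons; exact: CmeasurableM.
Qed.

End ComplexMeasurable.

Section FactorMap.
Context {R : realType} {G : groupType} {l : nat}.
Variables (f : 'I_l -> G -> disk R) (F : nat -> {fset G}) (a : G -> R) (b : nat -> R).
Context {d : measure_display} {X : measurableType d}.
Variables (mu : probability X R) (T : G -> X -> X) (Fs : 'I_l -> X -> R[i]%C).
Hypotheses (cG : countable [set: G]) (scheme : averaging_scheme F a b)
  (mpT : measure_preserving_action mu T) (LFs : forall j, Linfty mu (Fs j))
  (corr : forall (r : nat) (gs : 'I_r -> G) (j : 'I_r -> 'I_l) (c : 'I_r -> bool),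
     average F a b (shifted_product f gs j c) @ \oo -->
     (Cintegral mu (fun x =>
        \prod_(i < r) maybe_conj (c i) (Fs (j i) (T (gs i) x))) : R[i]%C^o)).
Local Open Scope complex_scope.

Lemma norm_maybe_conj c (z : R[i]) : `|maybe_conj c z| = `|z|.
Proof. by case: c => //=; case: z => p q; rewrite !normc_def/= sqrrN. Qed.

Lemma measurable_Fs (u : R[i]^o -> R) j :
  continuous u -> measurable_fun setT (fun x => u (Fs j x)).
Proof.
move=> cu; apply: (@measurability _ _ X _ setT (fun x => u (Fs j x)) _
  (RGenOInfty.measurableE R)) => _ [_ [t ->] <-].
rewrite setTI; have [mFs _] := LFs j.
have := mFs (u @^-1` `]t, +oo[%classic); apply.
by apply: open_comp; [move=> z _; exact: cu|exact: interval_open].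
Qed.

Lemma Cmeasurable_Fs c j g : Cmeasurable (fun x => maybe_conj c (Fs j (T g x))).
Proof.
have [_ _ mT _] := mpT; apply: Cmeasurable_conj; split.
  exact: (measurableT_comp (measurable_Fs j continuous_Re) (mT g)).
exact: (measurableT_comp (measurable_Fs j continuous_Im) (mT g)).
Qed.

Let sqn (z : R[i]) : R := complex.Re z ^+ 2 + complex.Im z ^+ 2.

Let measurable_sqn j : measurable_fun setT (fun x => sqn (Fs j x)).
Proof.
by apply: measurable_funD; apply: measurable_funX;
  [exact: measurable_Fs continuous_Re|exact: measurable_Fs continuous_Im].
Qed.

(** The [r]-th moment of [`|Fs j| ^+ 2] is the limit of averages of
    [`|f j| ^+ 2r], which is at most 1. *)
Lemma moments_le1 j r : (\int[mu]_x (sqn (Fs j x) ^+ r) <= 1)%R.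
Proof.
have [T1 _ _ _] := mpT.
(* Factors with odd index are conjugated, so they pair up to squared norms. *)
have prodE z : \prod_(i < r.*2) maybe_conj (odd i) z = (sqn z ^+ r)%:C.
  elim: r => [|r' IH]; first by rewrite big_ord0 expr0.
  rewrite doubleS !big_ord_recr/= IH odd_double/= -mulrA exprSr rmorphM/=.
  congr (_ * _); rewrite /sqn; case: z {IH} => p q; apply/eqP.
  by rewrite eq_complex/=; apply/andP; split; apply/eqP; ring.
have := @corr r.*2 (fun=> 1%g) (fun=> j) (fun i => odd i).
move=> /cvg_complexP[cRe _].
have -> : (\int[mu]_x (sqn (Fs j x) ^+ r))%R = complex.Re (Cintegral mu (fun x =>
    \prod_(i < r.*2) maybe_conj (odd i) (Fs j (T 1%g x)))).
  by apply: eq_Rintegral => x _; rewrite T1 prodE.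
apply: (ler_cvg_to cRe (cvg_mass scheme)); near=> N.
apply: (le_trans (ler_norm _)); apply: Re_le_norm.
rewrite -[mass _ _ _ _]mul1r; apply: average_bound => // g.
suff /andP[] : 0 <= `|shifted_product f (fun=> 1%g) (fun=> j)
  (fun i : 'I_r.*2 => odd i) g| <= 1 by [].
rewrite normr_prod; elim/big_ind: _ => [|x z /andP[x0 x1] /andP[z0 z1]|i _].
- by rewrite ler01 lexx.
- by rewrite mulr_ge0// mulr_ile1.
- by rewrite normr_ge0/= norm_maybe_conj; exact: (set_valP (f j (1 * g)%g)).
Unshelve. all: by end_near. Qed.

Lemma Fs_ae_le1 j : mu.-negligible [set x | ~ `|Fs j x| <= 1].
Proof.
have [_ [M FM]] := LFs j.
rewrite (_ : mkset _ = [set x | 1 < sqn (Fs j x)]).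
  apply: (@bounded_moments_ae_le1 _ _ _ mu _ (M * M + M * M)).
  - exact: measurable_sqn.
  - by move=> x; rewrite addr_ge0// sqr_ge0.
  - apply: filterS FM => x FM; rewrite /sqn.
    have := Re_le_norm FM; have := Im_le_norm FM; rewrite !ler_norml.
    by move=> /andP[? ?] /andP[? ?]; nra.
  - exact: moments_le1.
by apply/seteqP; split => x /=; rewrite norm_le1E ltNge => /negP.
Qed.

Definition in_disk : set X := [set x | forall g j, `|Fs j (T g x)| <= 1].

Lemma negligible_preimage g (N : set X) :
  mu.-negligible N -> mu.-negligible (T g @^-1` N).
Proof.
have [_ _ mT pT] := mpT; move=> [B [mB B0 NB]]; exists (T g @^-1` B); split.
- by rewrite -(setTI (_ @^-1` _)); exact: mT.
- by rewrite pT.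
- by move=> x /NB.
Qed.

Lemma in_disk_ae : mu.-negligible (~` in_disk).
Proof.
apply: (@negligibleS _ _ _ mu
  (\bigcup_(t : G * 'I_l) T t.1 @^-1` [set x | ~ `|Fs t.2 x| <= 1])).
  by move=> x /existsNP[g /existsNP[j Fx]]; exists (g, j).
apply: negligible_countable_bigcup => [|[g j]].
  by rewrite -setXTT; apply: countableX => //; exact: countableP.
exact: negligible_preimage (Fs_ae_le1 j).
Qed.

(** Points off the disk go to 0, so that the factor map is defined and
    equivariant on all of [X] and not only almost everywhere. *)
Definition clamp (z : R[i]) : disk R :=
  insubd (exist _ (0 : R[i]^o) (disk0_subproof R) :
    set_type [set z : R[i]^o | `|z| <= 1]) (z : R[i]^o).

Lemma clampE (z : R[i]) : (clamp z : R[i]) = if `|z| <= 1 then z else 0.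
Proof.
rewrite /complex_of_disk /clamp val_insubd; case: ifPn => [|zn].
  by rewrite inE /= => ->.
by rewrite ifN//; apply: contra zn => z1; rewrite inE.
Qed.

Definition factor_map (x : X) : shift_space R G l :=
  fun g j => clamp (Fs j (T g x)).

Lemma factor_map_equivariant g x :
  factor_map (T g x) = shift_action g (factor_map x).
Proof.
have [_ TM _ _] := mpT.
by apply/funext => g0; apply/funext => j; rewrite /factor_map /shift_action TM.
Qed.

Lemma factor_mapE x g j : in_disk x -> (factor_map x g j : R[i]) = Fs j (T g x).
Proof. by move=> /(_ g j) Fx; rewrite clampE Fx. Qed.

Lemma measurable_real_coordinate t :
  measurable_fun setT (real_coordinate t \o factor_map).
Proof.
have [_ _ mT _] := mpT; case: t => [[g j] c].
rewrite (_ : _ \o _ = (fun x => if sqn (Fs j x) <= 1 then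
    (if c then complex.Im (Fs j x) else complex.Re (Fs j x)) else 0) \o T g).
  apply: measurableT_comp => //; apply: measurable_fun_ifT => //.
    exact: measurable_fun_ler.
  by case: c; [exact: measurable_Fs continuous_Im|exact: measurable_Fs continuous_Re].
apply/funext => x; rewrite /real_coordinate/= clampE norm_le1E -/(sqn _).
by case: c; case: ifP.
Qed.

Lemma measurable_factor_map : measurable_fun setT
  (factor_map : X -> g_sigma_algebraType (@open (shift_space R G l))).
Proof.
have [u [cu sepu uE]] := countable_coordinates (R := R) (l := l) cG.
apply: (separating_measurable (@compact_shift_space R G l) cu sepu) => k.
by case: (uE k) => [[t ->]|->]; [exact: measurable_real_coordinate|exact: measurable_cst].
Qed.

Definition factor_measure :
    probability (g_sigma_algebraType (@open (shift_space R G l))) R :=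
  distribution mu (mfun_Sub (mem_set measurable_factor_map)).

Let coord (k : G * 'I_l * bool) (y : shift_space R G l) : R[i]^o :=
  maybe_conj k.2 (y k.1.1 k.1.2 : R[i]).

Let continuous_coord k : continuous (coord k).
Proof.
case: k => [[g j] c]; apply: continuous_maybe_conj.
exact: (@continuous_coordinate R G l g j).
Qed.

Lemma Rintegral_factor_measure (u : shift_space R G l -> R) (v : X -> R) :
  continuous u -> measurable_fun setT v ->
  (forall x, in_disk x -> v x = u (factor_map x)) ->
  \int[mu]_x v x = \int[factor_measure]_y u y.
Proof.
move=> cu mv vu; rewrite /Rintegral; congr fine.
rewrite (@integral_pushforward _ _ _ _ _ _ measurable_factor_map)//; last 2 first.
- apply/measurable_EFinP; exact: continuous_borel_measurable.
- have [M M0 uM] := continuous_bounded (@compact_shift_space R G l) cu.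
  rewrite preimage_setT; apply: measurable_bounded_integrable => //.
  + by apply: (le_lt_trans (probability_le1 mu measurableT)); rewrite ltry.
  + exact: measurableT_comp (continuous_borel_measurable cu) measurable_factor_map.
  + exists M; split; first exact: num_real.
    by move=> N MN x _ /=; exact: (le_trans (uM _) (ltW MN)).
apply: ae_eq_integral => //.
- exact/measurable_EFinP.
- apply/measurable_EFinP.
  exact: measurableT_comp (continuous_borel_measurable cu) measurable_factor_map.
- apply: (negligibleS _ in_disk_ae) => x /= H D; apply: H => _.
  by rewrite vu.
Qed.

(** The average of a monomial along the orbit is an average of a product of
    translates of the [f j], and its limit is the integral of the monomial since
    [factor_map] has the coordinates [Fs j (T g x)] almost everywhere. *)
Theorem factor_measure_weak_star_limit :
  weak_star_limit F a b (fun g => shift_action g (orbit_point f)) factor_measure.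
Proof.
apply: (@weak_star_of_monomials _ _ _ _ _ _ _ _ scheme (@compact_shift_space R G l)
  _ coord (fun k => (k.1, ~~ k.2))).
- exact: continuous_coord.
- by move=> [[g j] []] y; rewrite /coord//= conjcK.
- move=> y y' yy'; have [t tyy'] := real_coordinate_separates yy'.
  exists (t.1, false); apply: contra tyy' => /eqP E.
  by rewrite /real_coordinate /=; move: E; rewrite /coord/= => ->.
move=> w; rewrite /average_cvg.
pose t i := tnth (in_tuple w) i.
have := @corr (size w) (fun i => (t i).1.1) (fun i => (t i).1.2) (fun i => (t i).2).
rewrite (_ : shifted_product _ _ _ _ = (fun g => \prod_(k <- w)
    coord k (shift_action g (orbit_point f)))); last first.
  by apply/funext => g; rewrite big_tnth.
rewrite (_ : Cintegral mu _ = Cintegral factor_measure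
    (fun y => \prod_(k <- w) coord k y)) //.
have /continuous_complexP[cRe cIm] :=
  @continuous_complex_prod _ _ _ w _ (@continuous_coord).
pose v x : R[i]^o := \prod_(k <- w) coord k (factor_map x).
have vE x : in_disk x -> \prod_(i < size w) maybe_conj (t i).2
    (Fs (t i).1.2 (T (t i).1.1 x)) = \prod_(k <- w) coord k (factor_map x).
  move=> Dx; rewrite [RHS]big_tnth; apply: eq_bigr => i _.
  by rewrite /coord factor_mapE.
have [mRe mIm] : Cmeasurable (fun x => \prod_(i < size w)
    maybe_conj (t i).2 (Fs (t i).1.2 (T (t i).1.1 x))).
  by apply: Cmeasurable_prod => i; exact: Cmeasurable_Fs.
congr (_ +i* _).
  by apply: Rintegral_factor_measure => // x Dx; rewrite vE.
by apply: Rintegral_factor_measure => // x Dx; rewrite vE.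
Qed.

End FactorMap.

(** * Completions and the isomorphism *)

Section Completion.
Context {R : realType} {d : measure_display} {Y : measurableType d}.
Variable nu : probability Y R.

Lemma completion_negligible (A N : set Y) :
  measurable A -> nu.-negligible N -> completion nu (A `|` N) = nu A.
Proof.
move=> mA [M [mM M0 NM]]; apply/eqP; rewrite eq_le; apply/andP; split; last first.
  by rewrite -(completionE nu mA) le_outer_measure//; left.
have mAM : measurable (A `|` M) by exact: measurableU.
apply: (@le_trans _ _ (nu (A `|` M))).
  rewrite -(completionE nu mAM); apply: le_outer_measure => x [|/NM]; first by left.
  by right.
apply: (le_trans (measureU2 _ mA mM)).
have leM : (nu M <= 0)%E by rewrite M0.
by apply: (le_trans (leeD (lexx _) leM)); rewrite adde0.
Qed.

Lemma completion_measurableP (A : set (completion_type nu)) :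
  measurable A <-> completed_algebra_gen nu A.
Proof. by rewrite completion_measurableE. Qed.

Lemma completion_measurable (A : set Y) :
  measurable A -> measurable (A : set (completion_type nu)).
Proof.
move=> mA; rewrite completion_measurableE; exists A => //.
by exists set0; [exact: negligible_set0|rewrite setU0].
Qed.

Lemma completion_is_complete : measure_is_complete (completion nu).
Proof.
move=> B [C [mC C0 BC]].
have [A mA [N nN AN]] := (completion_measurableP C).1 mC.
apply/completion_measurableP; exists set0 => //; exists B; last by rewrite set0U.
have A0 : nu A = 0%E by rewrite -(completion_negligible mA nN) AN.
have nA : nu.-negligible A by apply/negligibleP.
by apply: (negligibleS _ (negligibleU nA nN)); rewrite AN.
Qed.

End Completion.

Lemma negligible_setC (R : realType) (d : measure_display) (X : measurableType d)
    (mu : probability X R) (A : set X) :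
  measurable A -> mu (~` A) = 1%E <-> mu.-negligible A.
Proof.
move=> mA; split => [A1|nA].
  have A0 : mu A = 0%E.
    by have := probability_setC mu (measurableC mA); rewrite setCK A1 subee.
  exact/negligibleP.
have A0 : mu A = 0%E by exact/negligibleP.
by rewrite (probability_setC mu mA) A0 sube0.
Qed.

(** A measure preserving map from a complete space stays measurable and measure
    preserving when its target is completed. *)
Lemma measure_preserving_completion (R : realType) (d d' : measure_display)
    (X : measurableType d) (Y : measurableType d') (mu : probability X R)
    (nu : probability Y R) (phi : X -> Y) :
  measure_is_complete mu -> measurable_fun setT phi ->
  (forall A, measurable A -> mu (phi @^-1` A) = nu A) ->
  forall B : set (completion_type nu), measurable B ->
    measurable (phi @^-1` B) /\ mu (phi @^-1` B) = completion nu B.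
Proof.
move=> cmu mphi pphi B; rewrite completion_measurableE => -[A mA [N nN <-]].
have mpre (C : set Y) : measurable C -> measurable (phi @^-1` C).
  by move=> mC; rewrite -(setTI (_ @^-1` _)); exact: mphi.
have [M [mM M0 NM]] := nN.
have nphiN : mu.-negligible (phi @^-1` N).
  by exists (phi @^-1` M); split; [exact: mpre|rewrite pphi|move=> x /NM].
have mphiN := cmu _ nphiN.
have -> : phi @^-1` (A `|` N) = phi @^-1` A `|` phi @^-1` N by [].
have mU : measurable (phi @^-1` A `|` phi @^-1` N).
  by apply: measurableU => //; exact: mpre.
split => //; rewrite completion_negligible// -pphi//.
apply/eqP; rewrite eq_le; apply/andP; split; last first.
  by apply: le_measure; rewrite ?inE; [exact: mpre|exact: mU|left].
apply: (le_trans (measureU2 _ (mpre _ mA) mphiN)).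
have le0 : (mu (phi @^-1` N) <= 0)%E by rewrite (negligibleP _ mphiN).1.
by apply: (le_trans (leeD (lexx _) le0)); rewrite adde0.
Qed.

Lemma completion_measure_preserving_action (R : realType) (G : groupType)
    (d : measure_display) (Y : measurableType d) (nu : probability Y R)
    (S : G -> Y -> Y) :
  measure_preserving_action nu S ->
  measure_preserving_action (completion nu)
    (S : G -> completion_type nu -> completion_type nu).
Proof.
move=> [S1 SM mS pS].
have S_completion g : forall B : set (completion_type nu), measurable B ->
    measurable (S g @^-1` B : set (completion_type nu)) /\
    completion nu (S g @^-1` B) = completion nu B.
  apply: (measure_preserving_completion (@completion_is_complete _ _ _ nu)).
    by move=> _ A mA; apply: completion_measurable; exact: mS.
  move=> A mA; rewrite -(pS g A mA); apply: completionE.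
  by rewrite -(setTI (_ @^-1` _)); exact: mS.
split => //.
  by move=> g _ B mB; rewrite setTI; exact: (S_completion g B mB).1.
by move=> g B mB; exact: (S_completion g B mB).2.
Qed.

Section FactorIsomorphism.
Context {R : realType} {G : groupType} {d : measure_display} {X : measurableType d}
  {Y : ptopologicalType}.
Variables (mu : probability X R) (T : G -> X -> X)
  (nu : probability (g_sigma_algebraType (@open Y)) R)
  (S : G -> Y -> Y) (phi : X -> g_sigma_algebraType (@open Y))
  (V : nat -> set Y).
Hypotheses (cG : countable [set: G]) (stdX : standard_system mu T)
  (hY : hausdorff_space Y) (oV : forall n, open (V n))
  (baseV : forall y (O : set Y), open O -> O y -> exists2 n, V n y & V n `<=` O)
  (mphi : measurable_fun setT phi)
  (pphi : forall A, measurable A -> mu (phi @^-1` A) = nu A)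
  (equiv : forall g x, phi (T g x) = S g (phi x))
  (gen : forall A : set X, measurable A ->
     exists B (N : set X), [/\ measurable B, mu.-negligible N &
       forall x, ~ N x -> (A x <-> B (phi x))]).

(** The sets that separate points come from [Y] up to null sets, so [phi]
    separates the points whose orbits avoid these countably many null sets. *)
Lemma factor_injective : exists X' : set X,
  [/\ measurable X', mu X' = 1%E, forall g x, X' x -> X' (T g x) &
      forall x x', X' x -> X' x' -> phi x = phi x' -> x = x'].
Proof.
have [[cmu _] [T1 TM mT pT]] := stdX.
have [X0 [A [mX0 X01 mA sep]]] := lebesgue_space_separating stdX.1.
have /choice[B BP] n : exists B : set (g_sigma_algebraType (@open Y)),
    exists N, mu.-negligible N /\ forall x, ~ N x -> (A n x <-> B (phi x)).
  by have [B [N [_ nN H]]] := gen (mA n); exists B, N.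
have /choice[N NP] n : exists N, mu.-negligible N /\
    forall x, ~ N x -> (A n x <-> B n (phi x)) by exact: BP.
(* Off [bad], equality of the images decides membership in every [A n]. *)
pose bad := ~` X0 `|` \bigcup_n N n.
have nbad : mu.-negligible bad.
  apply: negligibleU; last by apply: negligible_bigcup => n; exact: (NP n).1.
  by apply/negligible_setC; [exact: measurableC|rewrite setCK].
have nbadT : mu.-negligible (\bigcup_g T g @^-1` bad).
  apply: negligible_countable_bigcup => // g.
  exact: (negligible_preimage stdX.2).
have mbadT := cmu _ nbadT.
exists (~` \bigcup_g T g @^-1` bad); split.
- exact: measurableC.
- exact/negligible_setC.
- by move=> g x nx [h _ hx]; apply: nx; exists (h * g)%g => //=; rewrite TM.
have good x : (~` \bigcup_g T g @^-1` bad) x -> ~ bad x.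
  by move=> nx bx; apply: nx; exists 1%g => //=; rewrite T1.
move=> x x' /good/not_orP[/contrapT X0x nNx] /good/not_orP[/contrapT X0x' nNx'] E.
apply: sep => // n; rewrite (NP n).2; last by move=> Nx; apply: nNx; exists n.
by rewrite (NP n).2 ?E// => Nx; apply: nNx'; exists n.
Qed.

(** A factor map onto a Borel space is an isomorphism as soon as it generates
    the sigma-algebra of a Lebesgue space up to null sets. *)
Theorem factor_isomorphism :
  isomorphic_systems mu T (completion nu)
    (S : G -> completion_type nu -> completion_type nu).
Proof.
have [lX [_ _ _ _]] := stdX; have [cmu _] := lX.
have [X' [mX' X'1 TX' phi_inj]] := factor_injective.
have pre := measure_preserving_completion cmu mphi pphi.
(* The image of [A] contains a Borel set of measure at least [mu A] and misses
   one of measure at least [1 - mu A]. *)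
have img A : measurable A -> A `<=` X' ->
    exists E N, [/\ measurable E, nu.-negligible N, E `|` N = phi @` A &
      nu E = mu A].
  move=> mA AX'.
  have [E [mE EA muE]] := lebesgue_space_image lX hY oV baseV mphi mA.
  have mX'A : measurable (X' `\` A) by exact: measurableD.
  have [E' [mE' E'A muE']] := lebesgue_space_image lX hY oV baseV mphi mX'A.
  rewrite (pphi mE) in muE; rewrite (pphi mE') in muE'.
  have AE' : phi @` A `<=` ~` E'.
    move=> _ [x Ax <-] /E'A[x' [X'x' nAx'] xx'].
    by apply: nAx'; rewrite (phi_inj _ _ X'x' (AX' _ Ax) xx').
  have mu1 : (mu A + mu (X' `\` A) = 1)%E.
    rewrite -measureU//; last by rewrite setDIK.
    by rewrite setDUK.
  have finA : mu A \is a fin_num by exact: fin_num_measure.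
  have finE : nu E \is a fin_num by exact: fin_num_measure.
  have nE'A : (nu (~` E') <= mu A)%E.
    rewrite (probability_setC nu mE').
    rewrite leeBlDr ?fin_num_measure// -mu1 leeD2l//.
  have EE' : E `<=` ~` E' by apply: (subset_trans EA AE').
  have nuE : nu E = mu A.
    apply/eqP; rewrite eq_le muE andbT; apply: (le_trans _ nE'A).
    by apply: le_measure; rewrite ?inE//; exact: measurableC.
  exists E, (phi @` A `\` E); split => //.
    exists (~` E' `\` E); split.
    - by apply: measurableD => //; exact: measurableC.
    - apply/eqP; rewrite eq_le measure_ge0 andbT measureD//; last 2 first.
      + exact: measurableC.
      + by rewrite ltey_eq fin_num_measure//; exact: measurableC.
      by rewrite setIidr// leeBlDr// add0e; exact: (le_trans nE'A muE).
    - by move=> y [/AE' ? ?].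
  by rewrite setDUK.
have mimg A : measurable A -> A `<=` X' ->
    measurable (phi @` A : set (completion_type nu)).
  move=> mA /(img _ mA)[E [N [mE nN <- _]]]; rewrite completion_measurableE.
  by exists E => //; exists N.
exists X', (phi @` X'), phi; split.
- split => //.
  + split; first exact: mimg.
    have [E [N [mE nN <- nuE]]] := img _ mX' (@subset_refl _ _).
    exact: (etrans (completion_negligible mE nN) (etrans nuE X'1)).
  + split; [by move=> x Xx; exists x| |by move=> _ [x Xx <-]; exists x].
    by move=> x x' /set_mem Xx /set_mem Xx'; exact: phi_inj.
  + move=> B mB BY; have [mpB muB] := pre _ mB.
    split; first exact: measurableI.
    apply: (etrans _ muB); apply/eqP; rewrite eq_le; apply/andP; split.
      by apply: le_measure; rewrite ?inE;
        [exact: measurableI|exact: mpB|move=> x []].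
    rewrite -[in leLHS](setIT (phi @^-1` B)) -(setUv X') setIUr.
    apply: (le_trans (measureU2 _ _ _)).
    * exact: measurableI.
    * by apply: measurableI => //; exact: measurableC.
    rewrite setIC -[leRHS]adde0; apply: leeD => //.
    have nX' : mu.-negligible (~` X').
      by apply/negligible_setC; [exact: measurableC|rewrite setCK].
    have mX'C : measurable (phi @^-1` B `&` ~` X').
      by apply: measurableI => //; exact: measurableC.
    have mu0 : mu (phi @^-1` B `&` ~` X') = 0%E.
      by apply/negligibleP => //; apply: negligibleS nX' => x [].
    by have : (mu (phi @^-1` B `&` ~` X') <= 0)%E by rewrite mu0.
- by [].
- by move=> g _ [x Xx <-]; exists (T g x); [exact: TX'|exact: equiv].
- by move=> g x _; exact: equiv.
Qed.

End FactorIsomorphism.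

(** * Furstenberg systems are isomorphic to their shift models *)

Section FurstenbergModel.
Context {R : realType} {G : groupType} {l : nat}.
Context {d : measure_display} {X : measurableType d}.
Variables (mu : probability X R) (T : G -> X -> X) (Fs : 'I_l -> X -> R[i]%C).
Hypotheses (cG : countable [set: G]) (mpT : measure_preserving_action mu T).
Local Notation Y := (shift_space R G l).
Local Notation borelY := (g_sigma_algebraType (@open Y)).

Lemma measurable_shift_action g :
  measurable_fun setT (shift_action g : borelY -> borelY).
Proof.
have [u [cu sepu uE]] := countable_coordinates (R := R) (l := l) cG.
apply: (separating_measurable (@compact_shift_space R G l) cu sepu) => k.
case: (uE k) => [[[[h j] c] ->]|->]; last exact: measurable_cst.
exact: (continuous_borel_measurable
  (@continuous_real_coordinate R G l ((h * g)%g, j, c))).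
Qed.

(** The sets that agree with a preimage from the shift space up to a null set
    form an invariant sigma-algebra. *)
Lemma measurable_mod_negligible :
  mu.-negligible (~` in_disk T Fs) ->
  (measurable : set (set X)) =
    <<s invariant_sigma_algebra T Fs `|` mu.-negligible >> ->
  forall A : set X, measurable A -> exists (B : set borelY) (N : set X),
    [/\ measurable B, mu.-negligible N &
        forall x, ~ N x -> (A x <-> B (factor_map T Fs x))].
Proof.
move=> nD gen.
pose C : set (set X) := [set A | exists (B : set borelY) (N : set X),
    [/\ measurable B, mu.-negligible N &
        forall x, ~ N x -> (A x <-> B (factor_map T Fs x))]].
have sC : sigma_algebra setT C.
  split.
  - exists set0, set0; split; [exact: measurable0|exact: negligible_set0|by []].
  - move=> A [B [N [mB nN AB]]]; exists (~` B), N; split => //.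
      exact: measurableC.
    by move=> x Nx; rewrite setTD /=; split => nA H; apply: nA; apply/AB.
  - move=> A CA.
    have /choice[B /choice[N BN]] : forall n, exists B N, [/\ measurable (B : set borelY),
        mu.-negligible N & forall x, ~ N x -> (A n x <-> B (factor_map T Fs x))] by [].
    exists (\bigcup_n B n), (\bigcup_n N n); split.
    + by apply: bigcupT_measurable => n; case: (BN n).
    + by apply: negligible_bigcup => n; case: (BN n).
    move=> x nNx; have AB n : A n x <-> B n (factor_map T Fs x).
      by case: (BN n) => _ _; apply => Nx; apply: nNx; exists n.
    by split=> -[n _ H]; exists n => //; apply/AB.
suff sub : <<s invariant_sigma_algebra T Fs `|` mu.-negligible >> `<=` C.
  by move=> A mA; apply: sub; rewrite -gen.
apply: smallest_sub => // A [|nA]; last first.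
  by exists set0, A.
move: A; apply: smallest_sub.
  split => // g A [B [N [mB nN AB]]].
  exists (shift_action g @^-1` B), (T g @^-1` N); split.
  - by rewrite -(setTI (_ @^-1` _)); exact: (measurable_shift_action g).
  - exact: (negligible_preimage mpT).
  - by move=> x Nx; rewrite /= -(factor_map_equivariant _ mpT); exact: AB.
move=> _ [j [W [oW ->]]].
exists ((fun y : Y => (y 1%g j : R[i]%C) : R[i]%C^o) @^-1` W), (~` in_disk T Fs).
split => //.
  apply: sub_sigma_algebra; apply: open_comp => // y _.
  exact: (@continuous_coordinate R G l 1%g j).
have [T1 _ _ _] := mpT.
by move=> x /contrapT Dx; rewrite /= factor_mapE// T1.
Qed.

End FurstenbergModel.

Theorem theoremA4 (R : realType) (G : groupType) (l : nat)
    (F : nat -> {fset G}) (a : G -> R) (b : nat -> R)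
    (f : 'I_l -> G -> disk R)
    (d : measure_display) (X : measurableType d) (mu : probability X R)
    (T : G -> X -> X)
    (hG : countable [set: G]) (hamen : amenable R G)
    (hscheme : averaging_scheme F a b)
    (hacc : accordant f F a b)
    (hX : furstenberg_system f F a b mu T) :
  let y (g : G) : shift_space R G l := shift_action g (orbit_point f) in
  (exists nu : probability (borel_type (shift_space R G l)) R,
     weak_star_limit F a b y nu) /\
  forall nu : probability (borel_type (shift_space R G l)) R,
    weak_star_limit F a b y nu ->
    let S (g : G) : completion_type nu -> completion_type nu := shift_action g in
    measure_preserving_action (completion nu) S /\
    isomorphic_systems mu T (completion nu) S.
Proof.
move=> y; have [stdX [Fs [LFs corr gen]]] := hX.
have mpT := stdX.2.
have lim0 : weak_star_limit F a b y (factor_measure hG mpT LFs).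
  exact: factor_measure_weak_star_limit.
split; first by exists (factor_measure hG mpT LFs).
move=> nu lim S.
have [u [cu sepu _]] := countable_coordinates (R := R) (l := l) hG.
have cY := @compact_shift_space R G l.
(* Every weak* limit is the image of [mu]. *)
have pphi (A : set (borel_type (shift_space R G l))) :
    measurable A -> mu (factor_map T Fs @^-1` A) = nu A.
  by move=> mA; rewrite -(weak_star_limit_unique cY cu sepu lim0 lim mA).
have mphi := measurable_factor_map hG mpT LFs.
have mpS : measure_preserving_action nu
    (fun g => shift_action g :
       borel_type (shift_space R G l) -> borel_type (shift_space R G l)).
  split.
  - by move=> x; apply/funext => g; rewrite /shift_action mulg1.
  - by move=> g h x; apply/funext => k; rewrite /shift_action mulgA.
  - by move=> g; exact: measurable_shift_action.
  - move=> g A mA; rewrite -!pphi//; last first.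
      by rewrite -(setTI (_ @^-1` _)); exact: measurable_shift_action.
    have [_ _ _ pT] := mpT; rewrite -[RHS](pT g); last first.
      by rewrite -(setTI (_ @^-1` _)); exact: mphi.
    congr (mu _); apply/funext => x /=.
    by rewrite (factor_map_equivariant _ mpT).
split; first exact: completion_measure_preserving_action mpS.
have [V [oV baseV]] := separating_countable_base cY cu sepu.
apply: (@factor_isomorphism R G d X (shift_space R G l) mu T nu
  (fun g => shift_action g) _ _ hG stdX (separating_hausdorff cu sepu) oV baseV mphi
  pphi).
  by move=> g x; rewrite (factor_map_equivariant _ mpT).
apply: measurable_mod_negligible => //.
exact: (in_disk_ae hG hscheme mpT LFs corr).
Qed.
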